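(* Let $\Omega\subset\mathbb{R}^n$, $n\ge 2$, be a domain having a ridge $\mathcal{R}(\Omega)$ and a sufficiently smooth boundary for Green's formula to hold. Let $\delta(\mathbf{x})=\operatorname{dist}(\mathbf{x},\mathbb{R}^n\setminus\Omega)$. Then for all $f\in C_0^\infty(\Omega\setminus\mathcal{R}(\Omega))$ and $p\in(1,\infty)$, $$\int_\Omega |\nabla\delta\cdot\nabla f|^p\,d\mathbf{x}\ \ge\ \left(\frac{p-1}{p}\right)^p\int_\Omega\left\{1-\frac{p\,\delta\,\Delta\delta}{p-1}\right\}\frac{|f|^p}{\delta^p}\,d\mathbf{x}.$$
   Context: A domain is an open connected set. For $\mathbf{x}\in\Omega$ let $N(\mathbf{x})=\{\mathbf{y}\in\partial\Omega: |\mathbf{y}-\mathbf{x}|=\delta(\mathbf{x})\}$ be the set of near points of $\mathbf{x}$ on $\partial\Omega$. The skeleton of $\Omega$ is $\mathcal{S}(\Omega)=\{\mathbf{x}\in\Omega: \operatorname{card}N(\mathbf{x})>1\}$. For $\mathbf{x}\in\Omega$ and $\mathbf{y}\in N(\mathbf{x})$ put $\lambda=\sup\{t\in(0,\infty): \mathbf{y}\in N(\mathbf{y}+t[\mathbf{x}-\mathbf{y}])\}$; the point $\mathbf{y}+\lambda[\mathbf{x}-\mathbf{y}]$ (when $\lambda<\infty$) is the ridge point of $\mathbf{x}$, and the ridge $\mathcal{R}(\Omega)$ is the set of all ridge points of points of $\Omega$. One has $\mathcal{S}(\Omega)\subseteq\mathcal{R}(\Omega)\subseteq\overline{\mathcal{S}(\Omega)}$.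 It is assumed throughout that $\mathcal{R}(\Omega)$ is closed relative to $\Omega$, so that $\mathcal{R}(\Omega)=\overline{\mathcal{S}(\Omega)}$. *)

(* Defs.v *)
From HB Require Import structures.
From mathcomp Require Import all_boot all_order all_algebra.
From mathcomp Require Import all_classical all_reals all_analysis.

Set Implicit Arguments.
Unset Strict Implicit.
Unset Printing Implicit Defensive.

Import Order.TTheory GRing.Theory Num.Theory.
Import numFieldNormedType.Exports.

Local Open Scope classical_set_scope.
Local Open Scope ring_scope.

Section rV_measurable.
Context {R : realType} {n : nat}.

Definition rV_coord (i : 'I_n) (v : 'rV[R]_n) : measurableTypeR R := v 0 i.

Let rV_set0 : g_sigma_preimage rV_coord set0.
Proof. exact: sigma_algebra0. Qed.

Let rV_setC A : g_sigma_preimage rV_coord A -> g_sigma_preimage rV_coord (~` A).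
Proof. exact: sigma_algebraC. Qed.

Let rV_bigcup (F : (set _)^nat) : (forall i, g_sigma_preimage rV_coord (F i)) ->
  g_sigma_preimage rV_coord (\bigcup_i (F i)).
Proof. exact: sigma_algebra_bigcup. Qed.

(* The product sigma-algebra, which is the Borel one since R is second
   countable. *)
HB.instance Definition _ := @isMeasurable.Build default_measure_display
  'rV[R]_n (g_sigma_preimage rV_coord) rV_set0 rV_setC rV_bigcup.

Lemma measurable_rV_coord (i : 'I_n) : measurable_fun setT (rV_coord i).
Proof.
move=> _ Y mY; rewrite setTI; apply: sub_sigma_algebra => /=.
rewrite -bigcup_seq/=; exists i => /=; first by rewrite mem_index_enum.
by exists Y => //; rewrite setTI.
Qed.

Lemma measurable_fun_rV d (T : measurableType d) (f : T -> 'rV[R]_n) :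
  (forall i, measurable_fun setT (rV_coord i \o f)) -> measurable_fun setT f.
Proof.
move=> mf _ A mA; rewrite setTI.
have : g_sigma_preimage (fun i => rV_coord i \o f) `<=` measurable.
  apply: smallest_sub; first exact: sigma_algebra_measurable.
  rewrite -bigcup_seq => B [i _ [C mC <-]]; exact: mf.
apply; rewrite g_sigma_preimage_comp.
by exists A => //; rewrite setTI.
Qed.

End rV_measurable.

Section rV_cons.
Context {R : realType} {n : nat}.

Definition rV_cons (p : measurableTypeR R * 'rV[R]_n) : 'rV[R]_n.+1 :=
  \row_i (if unlift ord0 i is Some j then p.2 0 j else p.1).

Definition rV_uncons (v : 'rV[R]_n.+1) : measurableTypeR R * 'rV[R]_n :=
  (v 0 ord0, \row_j v 0 (lift ord0 j)).

Lemma rV_consK : cancel rV_cons rV_uncons.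
Proof.
case=> x v; rewrite /rV_uncons /rV_cons mxE unlift_none /=; congr pair.
by apply/rowP => j; rewrite !mxE liftK.
Qed.

Lemma rV_unconsK : cancel rV_uncons rV_cons.
Proof.
move=> v; apply/rowP => i; rewrite mxE.
by case: unliftP => [j ->|->] //=; rewrite mxE.
Qed.

Lemma measurable_rV_cons : measurable_fun setT rV_cons.
Proof.
apply: measurable_fun_rV => i; rewrite /comp /rV_coord /rV_cons.
case: (unliftP ord0 i) => [j ->|->].
  rewrite (_ : (fun _ => _) = rV_coord j \o snd); last first.
    by apply/funext => p; rewrite mxE liftK.
  apply: measurableT_comp; [exact: measurable_rV_coord|exact: measurable_snd].
rewrite (_ : (fun _ => _) = fst); last first.
  by apply/funext => p; rewrite mxE unlift_none.
exact: measurable_fst.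
Qed.

Lemma measurable_rV_uncons : measurable_fun setT rV_uncons.
Proof.
apply/measurable_fun_pair => /=; first exact: (measurable_rV_coord ord0).
apply: measurable_fun_rV => i.
rewrite (_ : _ \o _ = rV_coord (lift ord0 i)); first exact: measurable_rV_coord.
by apply/funext => v; rewrite /= /rV_coord mxE.
Qed.

End rV_cons.

Section lebesgue_rV_step.
Context {R : realType} {n : nat}.
Variable m : {sigma_finite_measure set 'rV[R]_n -> \bar R}.

Definition lebesgue_rV_step : set 'rV[R]_n.+1 -> \bar R :=
  pushforward (lebesgue_measure \x m)%E rV_cons.

Let mstep : {measure set 'rV[R]_n.+1 -> \bar R} :=
  measure_function_pushforward__canonical__measure_function_Measure
    (lebesgue_measure \x m)%E measurable_rV_cons.

Let step0 : lebesgue_rV_step set0 = 0%E.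
Proof. exact: (measure0 mstep). Qed.

Let step_ge0 A : (0 <= lebesgue_rV_step A)%E.
Proof. exact: (measure_ge0 mstep). Qed.

Let step_sigma_additive : semi_sigma_additive lebesgue_rV_step.
Proof. exact: (@measure_semi_sigma_additive _ _ _ mstep). Qed.

HB.instance Definition _ := isMeasure.Build _ _ _ lebesgue_rV_step
  step0 step_ge0 step_sigma_additive.

Let step_sigma_finite : sigma_finite setT lebesgue_rV_step.
Proof.
have /sigma_finiteP[F [FT ndF Foo]] := sigma_finiteT (@lebesgue_measure R).
have /sigma_finiteP[G [GT ndG Goo]] := sigma_finiteT m.
exists (fun k => rV_uncons @^-1` (F k `*` G k)).
  rewrite -preimage_bigcup -(_ : [set: _] = \bigcup_k (F k `*` G k)).
    by rewrite preimage_setT.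
  apply/seteqP; split=> [[x y] _|//].
  have [k _ Fkx] : (\bigcup_k F k) x by rewrite -FT.
  have [l _ Gly] : (\bigcup_k G k) y by rewrite -GT.
  exists (maxn k l) => //; split => /=.
    by move: x Fkx; exact/subsetPset/ndF/leq_maxl.
  by move: y Gly; exact/subsetPset/ndG/leq_maxr.
move=> k; have [mF Fk] := Foo k; have [mG Gk] := Goo k; split.
  rewrite -[X in measurable X]setTI.
  by apply: measurable_rV_uncons => //; exact: measurableX.
rewrite /lebesgue_rV_step /pushforward -comp_preimage.
rewrite (_ : rV_uncons \o rV_cons = id); last first.
  by apply/funext => q; exact: rV_consK.
by rewrite preimage_id product_measure1E// lte_mul_pinfty// ge0_fin_numE.
Qed.

HB.instance Definition _ := Measure_isSigmaFinite.Build _ _ _ lebesgue_rV_step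
  step_sigma_finite.

End lebesgue_rV_step.

(* Lebesgue measure on R^n, as the n-fold product of Lebesgue measure on R;
   on the one-point space R^0 it is the unit mass. *)
Fixpoint lebesgue_rV {R : realType} (n : nat) :
    {sigma_finite_measure set 'rV[R]_n -> \bar R} :=
  if n is n'.+1 then lebesgue_rV_step (lebesgue_rV n')
  else dirac (0 : 'rV[R]_0).

Lemma lebesgue_rV_box (R : realType) (n : nat)
    (A : 'I_n -> set (measurableTypeR R)) :
  (forall i, measurable (A i)) ->
  lebesgue_rV n [set v | forall i, A i (v 0 i)] =
  (\prod_(i < n) lebesgue_measure (A i))%E.
Proof.
elim: n A => [|n IH] A mA.
  by rewrite big_ord0 /= diracE mem_set// => -[].
rewrite big_ord_recl /= /lebesgue_rV_step /pushforward.
rewrite (_ : _ @^-1` _ = A ord0 `*`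
   [set v : 'rV[R]_n | forall i, A (lift ord0 i) (v 0 i)]); last first.
  apply/seteqP; split=> -[x v] /=.
    move=> H; split; first by have := H ord0; rewrite mxE unlift_none.
    by move=> i; have := H (lift ord0 i); rewrite mxE liftK.
  move=> [H0 H] i; rewrite mxE.
  by case: unliftP => [j ->|->] //=.
have mB : measurable [set v : 'rV[R]_n | forall i, A (lift ord0 i) (v 0 i)].
  rewrite (_ : [set _ | _] =
      \bigcap_(i in [set: 'I_n]) (rV_coord i @^-1` A (lift ord0 i))).
    apply: fin_bigcap_measurable => // i _.
    by rewrite -[X in measurable X]setTI; exact: measurable_rV_coord.
  by apply/seteqP; split=> v /= H i; [move=> _; exact: H|exact: (H i)].
rewrite product_measure1E//; congr (_ * _)%E.
by apply: (IH (fun i => A (lift ord0 i))) => i; exact: mA.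
Qed.

Section euclidean.
Context {R : realType} {n : nat}.
Implicit Types (x y : 'rV[R]_n) (f : 'rV[R]_n -> R) (A : set 'rV[R]_n).

Definition dotv x y : R := \sum_(i < n) x 0 i * y 0 i.

(* The norm `|x| that the library puts on 'rV[R]_n is the sup norm; it induces
   the same topology as the Euclidean norm. *)
Definition enorm x : R := Num.sqrt (dotv x x).

(* Euclidean distance to a set; 0 by convention when A is empty. *)
Definition edist x A : R := inf [set enorm (x - y) | y in A].

Definition unitv (i : 'I_n) : 'rV[R]_n := delta_mx 0 i.

Definition partial (i : 'I_n) f : 'rV[R]_n -> R := fun x => 'D_(unitv i) f x.

Definition grad f x : 'rV[R]_n := \row_i partial i f x.

(* Pointwise Laplacian.  [derive] has a default value where the limit does not
   exist; for the distance function of a domain this concerns, away from a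
   relatively closed ridge, only a null set, since the distance function is
   locally C^{1,1} there (and C^2 if the boundary is C^2). *)
Definition laplacian f x : R := \sum_(i < n) partial i (partial i f) x.

Definition divergence (F : 'rV[R]_n -> 'rV[R]_n) x : R :=
  \sum_(i < n) partial i (fun z => F z 0 i) x.

Definition C1 f : Prop :=
  continuous f /\ forall i, (forall x, derivable f x (unitv i)) /\
                            continuous (partial i f).

Fixpoint partials (s : seq 'I_n) f : 'rV[R]_n -> R :=
  if s is i :: s' then partial i (partials s' f) else f.

Definition Cinfty f : Prop := forall s, C1 (partials s f).

(* f is extended by 0 to the whole space. *)
Definition C0infty A f : Prop :=
  [/\ Cinfty f, compact (closure [set x | f x != 0])
    & closure [set x | f x != 0] `<=` A].

Definition boundary A : set 'rV[R]_n := closure A `\` A°.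

End euclidean.

Section ridge.
Context {R : realType} {n : nat}.
Implicit Types (Omega : set 'rV[R]_n) (x y z : 'rV[R]_n).

Definition domain Omega : Prop := open Omega /\ connected Omega.

Definition delta Omega x : R := edist x (~` Omega).

Definition near_points Omega x : set 'rV[R]_n :=
  [set y | boundary Omega y /\ enorm (y - x) = delta Omega x].

(* The number lambda of the pair (x, y); it is +oo when there is no ridge point
   on the ray from y through x. *)
Definition ridge_ratio Omega x y : \bar R :=
  ereal_sup [set t%:E | t in
    [set t : R | 0 < t /\ near_points Omega (y + t *: (x - y)) y]].

Definition ridge Omega : set 'rV[R]_n :=
  [set z | exists x y, exists lambda : R,
    [/\ Omega x, near_points Omega x y, ridge_ratio Omega x y = lambda%:E
      & z = y + lambda *: (x - y)]].

Definition closed_relative Omega (A : set 'rV[R]_n) : Prop :=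
  closure A `&` Omega `<=` A.

(* Green's (Gauss-Green) formula holds on Omega.  The surface measure sigma and
   the unit normal nu are not constructed from the boundary, because the
   identity determines them: sigma on Borel sets, and nu sigma-almost
   everywhere.  Every domain with C^1, or merely Lipschitz, boundary qualifies. *)
Definition green_formula Omega : Prop :=
  exists (sigma : {measure set 'rV[R]_n -> \bar R})
         (nu : 'rV[R]_n -> 'rV[R]_n),
    [/\ forall K, compact K -> (sigma K < +oo)%E,
        sigma (~` boundary Omega) = 0%E,
        measurable_fun setT nu,
        forall y, boundary Omega y -> enorm (nu y) = 1
      & forall F : 'rV[R]_n -> 'rV[R]_n,
          (forall i, C1 (fun x => F x 0 i)) ->
          compact (closure [set x | F x != 0]) ->
          (\int[lebesgue_rV n]_(x in Omega) (divergence F x)%:E =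
           \int[sigma]_(y in boundary Omega) (dotv (F y) (nu y))%:E)%E].

End ridge.

(* Main.v *)
(* Every x in Omega off the ridge has a near point y, and the ball of centre x
   and radius delta x is contained in a larger ball of Omega that still touches
   the boundary at y.  Comparing delta with the distance to y and with the
   distance to the centre of the larger ball traps it between two paraboloids
   with the same tangent plane at x; as the ridge is relatively closed, their
   curvature is bounded near the support K of f.  Hence near K the gradient of
   delta exists, has norm 1 and is Lipschitz.  The vector field
   |f|^p delta^(1-p) grad delta, extended by 0, is then Lipschitz with compact
   support, so its partial derivatives, which exist almost everywhere on every
   line parallel to an axis, have integral 0.  Expanding its divergence and
   applying Young's inequality pointwise gives the result; Green's formula on
   Omega is not used because the field vanishes near the boundary. *)
From HB Require Import structures.
Require Import Defs.
From mathcomp Require Import all_boot all_order all_algebra.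
From mathcomp Require Import all_classical all_reals all_analysis.
From mathcomp Require Import measurable_realfun ring lra.

Set Implicit Arguments.
Unset Strict Implicit.
Unset Printing Implicit Defensive.

Import Order.TTheory GRing.Theory Num.Theory.
Import numFieldNormedType.Exports.

Local Open Scope classical_set_scope.
Local Open Scope ring_scope.

(** * Lipschitz functions of one real variable *)

Lemma lebesgue_stieltjes_measure_itv_oc (R : realType) (h : cumulative R R)
    (a b : R) : a <= b ->
  lebesgue_stieltjes_measure h `]a, b]%classic = (h b - h a)%:E.
Proof.
move=> ab; rewrite /lebesgue_stieltjes_measure /measure_extension.
by rewrite measurable_mu_extE/= ?wlength_itv_bnd//; exact: is_ocitv.
Qed.

(** The sum of the two measures agrees with Lebesgue measure on half-open intervals, and these
    values determine the latter. *)
Lemma lebesgue_stieltjes_measureD (R : realType) (h k : cumulative R R) :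
  (forall x, h x + k x = x) -> forall A, measurable A ->
  (lebesgue_stieltjes_measure h A + lebesgue_stieltjes_measure k A
   = lebesgue_measure A)%E.
Proof.
move=> hk A mA; apply/esym.
pose mu : {measure set (measurableTypeR R) -> \bar R} :=
  measure_add (lebesgue_stieltjes_measure h) (lebesgue_stieltjes_measure k).
have muE B : mu B =
  (lebesgue_stieltjes_measure h B + lebesgue_stieltjes_measure k B)%E.
  exact: measure_addE.
rewrite (@lebesgue_measure_unique R mu) ?muE// => X.
move=> /ocitvP[->|[[a b] /= ab ->]]; first by rewrite !measure0.
rewrite lebesgue_measure_itv/= lte_fin ab muE.
rewrite !lebesgue_stieltjes_measure_itv_oc ?(ltW ab)//.
by rewrite -!EFinD; congr EFin; have := hk a; have := hk b; lra.
Qed.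

(* The two Stieltjes measures add up to the Lebesgue measure, so that of h has a
   Radon-Nikodym density, which the Lebesgue differentiation theorem identifies
   with the derivative of h. *)
Lemma lebesgue_stieltjes_density (R : realType) (h k : cumulative R R) (M : R) :
  0 < M -> (forall x, h x + k x = x) ->
  exists phi : R -> R,
    [/\ lebesgue_measure.-integrable setT (EFin \o phi),
        (forall x : R, - M <= x <= M ->
          (\int[lebesgue_measure]_(t in `](- M)%R, x]) (phi t)%:E
          = (h x - h (- M)%R)%:E)%E)
      & {ae lebesgue_measure, forall x : R, - M < x < M ->
          is_derive x 1 h (phi x)}].
Proof.
move=> M0 hk.
have NMM : - M <= M by lra.
have mI (i : interval R) : measurable ([set` i] : set (measurableTypeR R)).
  exact: measurable_itv.
have mE := mI `]- M, M].
have Efin : (lebesgue_stieltjes_measure h `](- M)%R, M]%classic < +oo)%E.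
  by rewrite lebesgue_stieltjes_measure_itv_oc// ltry.
(* The restriction to []- M, M]] makes the measure finite, so that the Radon-Nikodym theorem
   applies. *)
pose nu : {finite_measure set (measurableTypeR R) -> \bar R} := mfrestr mE Efin.
have nuE A : measurable A ->
    nu A = lebesgue_stieltjes_measure h (A `&` `]- M, M]%classic).
  by [].
(* On a Lebesgue null set the two nonnegative Stieltjes measures have sum 0, hence both vanish. *)
have dom : nu `<< (@lebesgue_measure R).
  apply/null_content_dominatesP => A mA A0.
  have : (lebesgue_measure (A `&` `](- M)%R, M]) = 0 :> \bar R)%E.
    by apply: (@subset_measure0 _ _ _ _ _ A) => //; exact: measurableI.
  rewrite -(lebesgue_stieltjes_measureD hk)//; last exact: measurableI.
  by move/eqP; rewrite padde_eq0// => /andP[/eqP + _].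
have [F [F0 Ffin intF FE]] := radon_nikodym_sigma_finite dom.
pose phi := fine \o F.
have phiE : EFin \o phi = F.
  by apply/funext => x; rewrite /= fineK.
have intE (x : R) : - M <= x <= M ->
    (\int[lebesgue_measure]_(t in `](- M)%R, x]) (phi t)%:E
      = (h x - h (- M)%R)%:E)%E.
  move=> /andP[Mx xM]; have := FE `]- M, x]%classic (mI _).
  rewrite nuE; last exact: mI.
  rewrite (_ : _ `&` _ = `]- M, x]%classic); last first.
    apply/seteqP; split => y /=; rewrite !in_itv/=; first by case.
    by move=> /andP[-> yx]; split => //; exact: le_trans yx xM.
  rewrite lebesgue_stieltjes_measure_itv_oc// => ->.
  by apply: eq_integral => y _; rewrite -phiE.
exists phi; split => //; first by rewrite phiE.
have intphi A : measurable A -> lebesgue_measure.-integrable A (EFin \o phi).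
  move=> mA; rewrite phiE; exact: integrableS intF.
(* The integral of [phi] from [- M] has derivative [phi] almost everywhere; on []- M, M[] it differs
   from [h] by a constant. *)
have := @FTC1 R phi (BRight (- M)) (fun y => intphi _ (measurable_itv _)).
have locphi : locally_integrable [set: R] phi.
  by apply: open_integrable_locally; [exact: openT|exact: intphi].
move=> /(_ locphi); apply: filterS.
  exact: (ae_filter_ringOfSetsType (@lebesgue_measure R)).
move=> x /= H /andP[Mx xM].
have [] := H; first by rewrite lte_fin.
set G := fun x0 => _ => dG GE.
have : is_derive x 1 (fun y => G y + h (- M)) (phi x).
  have dG' : is_derive x 1 G (phi x).
    by rewrite -GE derive1E; exact: derivableP.
  by apply: is_derive_eq; rewrite addr0.
apply: near_eq_is_derive; near=> y.
have yM : - M <= y <= M.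
  have : y \in `]- M, M[ by near: y; apply: near_in_itvoo; rewrite in_itv/= Mx.
  by rewrite in_itv/= => /andP[/ltW -> /ltW ->].
by rewrite /G /Rintegral intE//= subrK.
Unshelve. all: by end_near. Qed.

Lemma near_lipschitz_continuous (R : realType) (V W : normedModType R)
    (u : V -> W) (C : R) (x : V) :
  (\forall y \near x, `|u x - u y| <= C * `|x - y|) -> {for x, continuous u}.
Proof.
move=> lipu; apply/cvgrPdist_le => e e0.
have C0 : 0 < `|C| + 1 by rewrite ltr_wpDl.
near=> y; apply: (@le_trans _ _ (C * `|x - y|)); first by near: y.
apply: (@le_trans _ _ ((`|C| + 1) * `|x - y|)).
  by rewrite ler_wpM2r// (le_trans (ler_norm _))// lerDl.
rewrite mulrC -ler_pdivlMr//; near: y.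
by apply: cvgr_dist_le; [exact: cvg_id|rewrite divr_gt0].
Unshelve. all: by end_near. Qed.

Lemma lipschitz_continuous (R : realType) (V W : normedModType R) (u : V -> W)
    (C : R) :
  (forall x y, `|u x - u y| <= C * `|x - y|) -> continuous u.
Proof. by move=> lipu x; apply: (near_lipschitz_continuous (C := C)); near=> y.
Unshelve. all: by end_near. Qed.

Section integral_derivative.
Variables (R : realType) (g D : R -> R) (L M : R).
Hypotheses (L0 : 0 < L) (lipg : forall x y, `|g x - g y| <= L * `|x - y|).
Hypothesis g0 : forall x, M <= `|x| -> g x = 0.
Hypotheses (mD : measurable_fun setT D) (D0 : forall x, M <= `|x| -> D x = 0).
Hypothesis gD : forall x, derivable g x 1 -> D x = 'D_1 g x.

(* For s = 1 and s = -1, two nondecreasing functions whose sum is the identity. *)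
Let h (s x : R) : R := (s * (g x / L) + x) / 2.

Let nondecreasing_h s : `|s| = 1 -> nondecreasing (h s).
Proof.
move=> s1 x y xy; rewrite /h ler_pM2r ?invr_gt0//.
have : `|s * ((g x - g y) / L)| <= y - x.
  rewrite normrM s1 mul1r normrM normfV (gtr0_norm L0) ler_pdivrMr//.
  by rewrite (le_trans (lipg _ _))// distrC ger0_norm ?subr_ge0// mulrC.
by rewrite mulrBl => /ler_normlP[_]; lra.
Qed.

Let right_continuous_h s x : h s @ at_right x --> h s x.
Proof.
apply: cvg_within_filter; apply: cvgMl; apply: cvgD; last exact: cvg_id.
by apply: cvgMr; apply: cvgMl; exact: (lipschitz_continuous lipg).
Qed.

(** By the density lemma [g] has the derivative [psi] almost everywhere in []- M, M[], so [D] is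
    free on a null set only. The integral of [psi] is the increment of [g] between two of its
    zeros. *)
Lemma integral_derivative_lipschitz :
  (\int[lebesgue_measure]_x (D x)%:E = 0)%E.
Proof.
have [M0|M0] := leP M 0.
  by apply: integral0_eq => x _; rewrite D0// (le_trans M0).
have nd1 := @nondecreasing_h 1 (normr1 _).
have ndN1 := @nondecreasing_h (- 1) (normrN1 _).
pose H : cumulative R R :=
  HB.pack (h 1) (isCumulative.Build R _ R (h 1) nd1 (@right_continuous_h 1)).
pose K : cumulative R R :=
  HB.pack (h (- 1))
    (isCumulative.Build R _ R (h (- 1)) ndN1 (@right_continuous_h (- 1))).
have HK x : H x + K x = x by rewrite /= /h; lra.
have [phi [intphi phiE dH]] := lebesgue_stieltjes_density M0 HK.
pose I : set R := `]- M, M[%classic.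
have mI : measurable I by exact: measurable_itv.
pose psi x := L * (2 * phi x - 1).
have measurable_psi (A : set R) : measurable_fun A psi.
  apply: measurable_funTS; apply: measurable_funM => //.
  apply: measurable_funB => //; apply: measurable_funM => //.
  by apply/measurable_EFinP; case/integrableP: intphi.
have intD : (\int[lebesgue_measure]_x (D x)%:E
    = \int[lebesgue_measure]_(x in I) (psi x)%:E)%E.
  rewrite (_ : (fun _ => _) = (EFin \o D) \_ I); last first.
    apply/funext => x; rewrite patchE; case: ifPn => //.
    rewrite notin_setE /I /= in_itv/= -ltr_norml => /negP.
    by rewrite -leNgt => /D0 ->.
  rewrite -integral_mkcond; apply: ae_eq_integral => //.
  - by apply/measurable_EFinP; exact: measurable_funTS.
  - by apply/measurable_EFinP; exact: measurable_psi.
  move: dH; apply: filterS.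
    exact: (ae_filter_ringOfSetsType (@lebesgue_measure R)).
  move=> x /= dHx; rewrite /I /= in_itv/= => /dHx {}dHx.
  (* The definition of [h 1] solved for [g], whose derivative can then be read off from [phi]. *)
  have gE : g = (L * 2) \*: h 1 - L \*: id.
    apply/funext => y.
    rewrite (_ : (_ - _) y = (L * 2) * h 1 y - L * y)// /h.
    by field; rewrite gt_eqF.
  have dg : is_derive x 1 g (psi x).
    rewrite gE; apply: is_derive_eq.
    by rewrite /psi /GRing.scale/=; lra.
  by rewrite gD ?derive_val//; exact: ex_derive.
rewrite intD /I integral_itv_bndo_bndc; last first.
  by apply/measurable_EFinP; exact: measurable_psi.
have muI : lebesgue_measure (`]- M, M]%classic : set R) = (M *+ 2)%:E.
  by rewrite lebesgue_measure_itv/= lte_fin ifT ?gtrN// -EFinD opprK.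
rewrite (_ : integral _ _ _ = \int[lebesgue_measure]_(x in `](- M)%R, M])
  ((L * 2)%:E * (phi x)%:E - L%:E))%E; last first.
  by apply: eq_integral => x _; rewrite -EFinM -EFinD /psi; congr EFin; ring.
have intI : lebesgue_measure.-integrable (`]- M, M]%classic : set R)
    (EFin \o phi).
  exact: integrableS intphi.
rewrite integralB//.
(* Since [g] vanishes at both end points, [h 1] is [M / 2] and [- M / 2] there, and both terms of
   the difference equal [2 * L * M]. *)
- rewrite integralZl// phiE; last by rewrite lexx andbT; lra.
  rewrite integral_cst//= muI -!EFinM -EFinD /h !g0 ?normrN ?ler_norm//.
  by congr EFin; field; rewrite gt_eqF.
- exact: integrableZl.
- apply: (@measurable_bounded_integrable _ _ _ _ (cst L)) => //.
    apply: (@eq_ind_r _ _ (fun x => (x < +oo)%E) (ltry _) _ muI).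
  by exists `|L|; split=> [|y Ly x _ /=]; [exact: num_real|exact: ltW].
Qed.
End integral_derivative.

(** * Borel measurability and Fubini on 'rV[R]_n *)

Section rV_borel.
Variables (R : realType) (n : nat).
Implicit Types (A U : set 'rV[R]_n) (f g : 'rV[R]_n -> R).

(** There are countably many open cubes with rational centre and radius [k.+1%:R^-1], and [U] is the
    union of those that it contains. *)
Lemma rV_open_measurable U : open U -> measurable U.
Proof.
move=> oU.
pose B (qk : 'rV[rat]_n * nat) : set 'rV[R]_n :=
  [set v | forall i, ball (ratr (qk.1 0 i) : R) (qk.2.+1%:R^-1) (v 0 i)].
have mB qk : measurable (B qk).
  rewrite (_ : B qk = \bigcap_(i in [set: 'I_n])
      (rV_coord i @^-1` ball (ratr (qk.1 0 i) : R) (qk.2.+1%:R^-1))).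
    apply: fin_bigcap_measurable => // i _.
    rewrite -[X in measurable X]setTI; apply: measurable_rV_coord => //.
    exact: measurable_ball.
  by apply/seteqP; split=> v /= H i; [move=> _; exact: H|exact: (H i)].
(* The second factor is everything or empty: it selects the cubes inside [U]. *)
rewrite (_ : U = \bigcup_qk (B qk `&` [set _ | B qk `<=` U])); last first.
  apply/seteqP; split=> [x Ux|x [qk _ [Bx /= BU]]]; last exact: BU.
  have /nbhs_ballP[e /= e0 eU] : nbhs x U by exact: open_nbhs_nbhs.
  (* Half of [e], because the radius is spent twice: from [x] to the centre and from the centre to
     [v]. *)
  have [k ke] : exists k, k.+1%:R^-1 < e / 2.
    have [k] := ltr_add_invr (divr_gt0 e0 (ltr0n R 2)).
    by rewrite add0r; exists k.
  have k0 : 0 < k.+1%:R^-1 :> R by rewrite invr_gt0.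
  have [q qx] : {q : 'I_n -> rat &
      forall i, `|ratr (q i) - x 0 i| < k.+1%:R^-1}.
    apply: (@choice _ _ (fun i r => `|ratr r - x 0 i| < k.+1%:R^-1)) => i.
    have [|r] := @rat_in_itvoo R (x 0 i - k.+1%:R^-1) (x 0 i + k.+1%:R^-1).
      by rewrite ltrD2l gtrN.
    by rewrite in_itv/= => rx; exists r; rewrite ltr_distl.
  exists (\row_i q i, k) => //; split => /= [i|v Bv].
    by rewrite mxE; exact: qx.
  apply: eU; split => // i j; rewrite ord1 (splitr e).
  apply: (@ball_triangle _ _ (ratr (q j) : R)).
    by apply: ball_sym; apply: (le_ball (ltW ke)); exact: qx.
  by apply: (le_ball (ltW ke)); have := Bv j; rewrite /= mxE.
apply: countable_bigcupT_measurable => // qk; apply: measurableI => //.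
have [BU|BU] := pselect (B qk `<=` U).
  by rewrite (_ : [set _ | _] = setT)//; apply/seteqP; split.
by rewrite (_ : [set _ | _] = set0)//; apply/seteqP; split.
Qed.

Lemma rV_closed_measurable A : closed A -> measurable A.
Proof. by move/closed_openC/rV_open_measurable/measurableC; rewrite setCK. Qed.

Lemma rV_continuous_measurable f : continuous f -> measurable_fun setT f.
Proof.
move=> /continuousP cf; apply: (measurability _ (RGenOpens.measurableE R)).
move=> _ [_ [a [b ->] <-]]; rewrite setTI; apply: rV_open_measurable.
exact/cf/interval_open.
Qed.

End rV_borel.

Section derivable_borel.
Variables (R : realType) (n : nat) (g : 'rV[R]_n -> R) (v : 'rV[R]_n).
Hypothesis cg : continuous g.

Let q (h : R) (x : 'rV[R]_n) : R := h^-1 *: (g (h *: v + x) - g x).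

Let continuous_q h : continuous (q h).
Proof.
move=> x; have gh : g (h *: v + y) @[y --> x] --> g (h *: v + x).
  apply: (cvg_comp (fun y => h *: v + y) g); last exact: cg.
  exact: (cvgD (cvg_cst (h *: v)) (@cvg_id _ (nbhs x))).
exact: (cvgZr (cvgB gh (@cg x))).
Qed.

(** Cauchy's criterion: for every [k] the difference quotients vary by at most [k.+1%:R^-1] over all
    small steps. For a fixed pair of steps this is a closed condition, and closedness survives the
    uncountable intersection over the steps. *)
Lemma measurable_derivable : measurable [set x | derivable g x v].
Proof.
rewrite (_ : [set _ | _] = \bigcap_k \bigcup_m \bigcap_(h in
    [set h : R * R | 0 < `|h.1| < m.+1%:R^-1 /\ 0 < `|h.2| < m.+1%:R^-1])
    [set x | `|q h.1 x - q h.2 x| <= k.+1%:R^-1]).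
  apply: bigcapT_measurable => k; apply: bigcupT_measurable => m.
  apply: rV_closed_measurable; apply: closed_bigI => h _.
  rewrite (_ : [set _ | _] = (fun x => `|q h.1 x - q h.2 x|) @^-1`
     [set y | y <= k.+1%:R^-1])//.
  apply: preimage_closed; last exact: closed_le.
  move=> x _.
  exact: (cvg_norm (cvgB (@continuous_q h.1 x) (@continuous_q h.2 x))).
apply/seteqP; split=> x /=.
- move=> /cauchy_cvgP/cauchyP xq k _.
  have [l /= xl] := xq (2 * k.+1%:R)^-1 ltac:(by rewrite invr_gt0).
  have [e /= e0 el] := (nbhs_ballP _ _).1 xl.
  have [m me] : exists m, m.+1%:R^-1 < e.
    by have [m] := ltr_add_invr e0; rewrite add0r; exists m.
  exists m => // -[h1 h2] /= [/andP[h10 h1m] /andP[h20 h2m]].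
  have qe h : 0 < `|h| -> `|h| < m.+1%:R^-1 -> `|l - q h x| < (2 * k.+1%:R)^-1.
    move=> h0 hm; apply: el; last by rewrite -normr_gt0.
    by rewrite /ball/= sub0r normrN (lt_trans hm).
  have := qe _ h10 h1m; have := qe _ h20 h2m; rewrite invfM.
  set r := k.+1%:R^-1; move: (q h1 x) (q h2 x) => a b.
  move=> /ltr_normlP[? ?] /ltr_normlP[? ?]; apply/ler_normlP; split; lra.
- move=> H; apply/cauchy_cvgP/cauchyP => e e0.
  have [k ke] : exists k, k.+1%:R^-1 < e.
    by have [k] := ltr_add_invr e0; rewrite add0r; exists k.
  have [m _ Hm] := H k I.
  (* The index [m.+2] gives a nonzero step strictly below [m.+1%:R^-1]. *)
  exists (q (m.+2%:R^-1) x); apply/nbhs_ballP.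
  exists (m.+1%:R^-1) => /=; first by rewrite invr_gt0.
  move=> h; rewrite /ball/= sub0r normrN => hm h0.
  apply: le_lt_trans ke; apply: (Hm (m.+2%:R^-1, h)) => /=; split.
    by rewrite gtr0_norm ?invr_gt0 ?ltr0n//= ltf_pV2 ?posrE ?ltr0n// ltr_nat.
  by rewrite normr_gt0 h0.
Qed.

(** A pointwise limit of the continuous quotients with steps [m.+1%:R^-1]. *)
Lemma measurable_derive : measurable_fun [set x | derivable g x v] ('D_v g).
Proof.
apply: (@measurable_fun_cvg _ _ _ _ (fun m => q m.+1%:R^-1)) => [m|x /= xg].
  by apply: measurable_funTS; apply: rV_continuous_measurable.
move: xg => /(cvgr_dnbhsP (fun h => q h x)); apply; split=> [m|].
  by rewrite invr_eq0.
exact: cvg_harmonic.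
Qed.

End derivable_borel.

(* Where g is not derivable, partial i g takes the constant default value of
   lim. *)
Lemma measurable_partial (R : realType) (n : nat) (g : 'rV[R]_n -> R)
    (i : 'I_n) : continuous g -> measurable_fun setT (partial i g).
Proof.
move=> cg; have mA := measurable_derivable (unitv i) cg.
rewrite -(setUv [set x | derivable g x (unitv i)]).
apply/measurable_funU => //; first exact: measurableC.
split; first exact: measurable_derive.
apply: (@eq_measurable_fun _ _ _ _ _ (cst point)) => // x.
by rewrite inE /= => /dvgP.
Qed.

Section lebesgue_rV_fubini.
Variables (R : realType) (n : nat).
Implicit Types F : 'rV[R]_n.+1 -> R.

Let m : {measure set _ -> \bar R} := (@lebesgue_measure R \x lebesgue_rV n)%E.

Let integrable_cons F : (lebesgue_rV n.+1).-integrable setT (EFin \o F) ->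
  m.-integrable setT (fun p => (F (rV_cons p))%:E).
Proof.
move=> /integrableP[mF iF]; apply/integrableP; split.
  exact: (measurableT_comp mF (@measurable_rV_cons R n)).
rewrite (le_lt_trans _ iF)//= /lebesgue_rV_step.
rewrite ge0_integral_pushforward//; first exact: measurable_rV_cons.
by apply/measurable_EFinP; apply: measurableT_comp; last exact/measurable_EFinP.
Qed.

Let integral_cons F : (lebesgue_rV n.+1).-integrable setT (EFin \o F) ->
  (\int[lebesgue_rV n.+1]_x (F x)%:E = \int[m]_p (F (rV_cons p))%:E)%E.
Proof.
move=> iF; rewrite /= /lebesgue_rV_step integral_pushforward//.
- exact: measurable_rV_cons.
- by case/integrableP: iF.
- exact: integrable_cons.
Qed.

(** Fubini's theorem with the first coordinate as the inner variable. This serves derivatives along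
    the first axis, [integral_lebesgue_rV_tail] those along the other axes. *)
Lemma integral_lebesgue_rV_head F :
  (lebesgue_rV n.+1).-integrable setT (EFin \o F) ->
  (forall v, \int[lebesgue_measure]_x (F (rV_cons (x, v)))%:E = 0)%E ->
  (\int[lebesgue_rV n.+1]_x (F x)%:E = 0)%E.
Proof.
move=> iF F0; rewrite integral_cons// -integral21_prod_meas1; last first.
  exact: integrable_cons.
by apply: integral0_eq => v _; exact: F0.
Qed.

Lemma integral_lebesgue_rV_tail F :
  (lebesgue_rV n.+1).-integrable setT (EFin \o F) ->
  (forall x, \int[lebesgue_rV n]_v (F (rV_cons (x, v)))%:E = 0)%E ->
  (\int[lebesgue_rV n.+1]_x (F x)%:E = 0)%E.
Proof.
move=> iF F0; rewrite integral_cons// -integral12_prod_meas1; last first.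
  exact: integrable_cons.
by apply: integral0_eq => x _; exact: F0.
Qed.

End lebesgue_rV_fubini.

(** [F] is bounded and vanishes off a cube, whose measure is finite as a product of finite
    lengths. *)
Lemma lebesgue_rV_integrable (R : realType) (n : nat) (F : 'rV[R]_n -> R)
    (C M : R) : measurable_fun setT F -> (forall x, `|F x| <= C) ->
  (forall (x : 'rV[R]_n) i, M <= `|x 0 i| -> F x = 0) ->
  (lebesgue_rV n).-integrable setT (EFin \o F).
Proof.
move=> mF FC F0.
pose I : set (measurableTypeR R) := `]- M, M[%classic.
have mI : measurable I by exact: measurable_itv.
pose A : set 'rV[R]_n := [set v | forall i, I (v 0 i)].
have mA : measurable A.
  rewrite (_ : A = \bigcap_(i in [set: 'I_n]) (rV_coord i @^-1` I)).
    apply: fin_bigcap_measurable => // i _.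
    by rewrite -[X in measurable X]setTI; exact: measurable_rV_coord.
  by apply/seteqP; split=> v /= H i; [move=> _; exact: H|exact: (H i)].
have Aoo : (lebesgue_rV n A < +oo)%E.
  rewrite (@lebesgue_rV_box R n (fun=> I))// big_const_ord.
  elim: (n) => [|k IH] /=; first by rewrite ltry.
  rewrite lte_mul_pinfty// ge0_fin_numE// lebesgue_measure_itv/=.
  by case: ifP; rewrite // -EFinB ltry.
rewrite (_ : EFin \o F = (EFin \o F) \_ A); last first.
  apply/funext => x; rewrite patchE; case: ifPn => //.
  rewrite notin_setE /A /= => /existsNP[i].
  by rewrite /I /= in_itv/= -ltr_norml => /negP; rewrite -leNgt => /F0 ->.
apply/(integrable_mkcond (EFin \o F) mA).
apply: (measurable_bounded_integrable mA Aoo).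
  exact: measurable_funTS.
exists C; split=> [|y Cy x _]; first exact: num_real.
exact: le_trans (FC x) (ltW Cy).
Qed.

(** Induction on the dimension: either axis [i] is the first one and the inner integral vanishes by
    the one-variable lemma, or it lies in the tail and the induction hypothesis applies to the
    slices. [D] is prescribed only where the derivative exists, which leaves room for the default
    values inside [weight_derive]. *)
Lemma integral_partial_lipschitz (R : realType) (n : nat) (i : 'I_n)
    (g D : 'rV[R]_n -> R) (L M C : R) : 0 < L ->
  (forall (x : 'rV[R]_n) h, `|g (h *: unitv i + x) - g x| <= L * `|h|) ->
  (forall (x : 'rV[R]_n) k, M <= `|x 0 k| -> g x = 0) ->
  measurable_fun setT D -> (forall x, `|D x| <= C) ->
  (forall (x : 'rV[R]_n) k, M <= `|x 0 k| -> D x = 0) ->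
  (forall x, derivable g x (unitv i) -> D x = partial i g x) ->
  (\int[lebesgue_rV n]_x (D x)%:E = 0)%E.
Proof.
move=> L0; elim: n => [|n IH] in i g D *; first by case: i.
move=> lipg g0 mD DC D0 gD.
have iD := lebesgue_rV_integrable mD DC D0.
have mDcons : measurable_fun setT (D \o rV_cons).
  by apply: measurableT_comp => //; exact: measurable_rV_cons.
case: (unliftP ord0 i) => [j|] ij.
- have consD h x v :
      rV_cons (x, h *: unitv j + v) = h *: unitv i + rV_cons (x, v).
    apply/rowP => k; rewrite !mxE ij/=.
    case: unliftP => [l ->|->] /=; last by rewrite mulr0 add0r.
    by rewrite !mxE eqxx/= (inj_eq lift_inj).
  apply: integral_lebesgue_rV_tail => // x.
  apply: (IH j (fun v => g (rV_cons (x, v)))) => //=.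
  + by move=> v h; rewrite consD lipg.
  + by move=> v k vk; apply: (g0 _ (lift ord0 k)); rewrite mxE liftK.
  + exact: (measurableT_comp mDcons (pair1_measurable x)).
  + by move=> v k vk; apply: (D0 _ (lift ord0 k)); rewrite mxE liftK.
  + move=> v; rewrite /partial /derivable /derive /=.
    under eq_fun do rewrite consD.
    exact: gD.
(* The factor 1 is the direction of the one-variable derivative, so that [consD] rewrites its
   difference quotients. *)
- have consD h x v : rV_cons (h * 1 + x, v) = h *: unitv i + rV_cons (x, v).
    apply/rowP => k; rewrite !mxE ij/=.
    by case: unliftP => [l ->|->] /=; rewrite ?mulr0 ?add0r.
  apply: integral_lebesgue_rV_head => // v.
  apply: (@integral_derivative_lipschitz _ (fun x => g (rV_cons (x, v)))
    _ L M) => //=.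
  + move=> x y; rewrite -{1}(subrK y x) -{1}(mulr1 (x - y)) consD; exact: lipg.
  + by move=> x vk; apply: (g0 _ ord0); rewrite mxE unlift_none.
  + exact: (measurableT_comp mDcons (pair2_measurable v)).
  + by move=> x vk; apply: (D0 _ ord0); rewrite mxE unlift_none.
  + move=> x; rewrite /derivable /derive /=.
    under eq_fun do rewrite consD.
    exact: gD.
Qed.

(** * The distance function near a compact set off the ridge *)

Section euclidean_norm.
Variables (R : realType) (n : nat).
Implicit Types (x y z : 'rV[R]_n) (a : R).

Lemma dotvC x y : dotv x y = dotv y x.
Proof. by apply: eq_bigr => i _; rewrite mulrC. Qed.

Lemma dotvDr x y z : dotv x (y + z) = dotv x y + dotv x z.
Proof. by rewrite -big_split; apply: eq_bigr => i _; rewrite mxE mulrDr. Qed.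

Lemma dotvZr a x y : dotv x (a *: y) = a * dotv x y.
Proof. by rewrite mulr_sumr; apply: eq_bigr => i _; rewrite mxE mulrCA. Qed.

Lemma dotvDl x y z : dotv (x + y) z = dotv x z + dotv y z.
Proof. by rewrite dotvC dotvDr !(dotvC z). Qed.

Lemma dotvZl a x y : dotv (a *: x) y = a * dotv x y.
Proof. by rewrite dotvC dotvZr dotvC. Qed.

Lemma dotvNr x y : dotv x (- y) = - dotv x y.
Proof. by rewrite -scaleN1r dotvZr mulN1r. Qed.

Lemma dotvNl x y : dotv (- x) y = - dotv x y.
Proof. by rewrite dotvC dotvNr dotvC. Qed.

Lemma dotv_unitv x (i : 'I_n) : dotv x (unitv i) = x 0 i.
Proof.
rewrite /dotv (bigD1 i)//= big1 ?addr0 => [|j ji]; rewrite !mxE eqxx/=.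
  by rewrite eqxx mulr1.
by rewrite (negbTE ji) mulr0.
Qed.

Lemma dotvv_ge0 x : 0 <= dotv x x.
Proof. by apply: sumr_ge0 => i _; rewrite -expr2 sqr_ge0. Qed.

Lemma enorm_ge0 x : 0 <= enorm x. Proof. exact: sqrtr_ge0. Qed.

Lemma sqr_enorm x : enorm x ^+ 2 = dotv x x.
Proof. by rewrite sqr_sqrtr// dotvv_ge0. Qed.

Lemma enormZ a x : enorm (a *: x) = `|a| * enorm x.
Proof.
by rewrite /enorm dotvZl dotvZr mulrA -expr2 sqrtrM ?sqr_ge0// sqrtr_sqr.
Qed.

Lemma enorm0 : enorm (0 : 'rV[R]_n) = 0.
Proof. by rewrite -(scale0r (0 : 'rV[R]_n)) enormZ normr0 mul0r. Qed.

Lemma enormN x : enorm (- x) = enorm x.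
Proof. by rewrite -scaleN1r enormZ normrN1 mul1r. Qed.

Lemma enormB x y : enorm (x - y) = enorm (y - x).
Proof. by rewrite -enormN opprB. Qed.

Lemma enorm_unitv (i : 'I_n) : enorm (unitv i : 'rV[R]_n) = 1.
Proof. by rewrite /enorm dotv_unitv mxE !eqxx sqrtr1. Qed.

Lemma coord_le_enorm x (i : 'I_n) : `|x 0 i| <= enorm x.
Proof.
rewrite -sqrtr_sqr ler_wsqrtr// /dotv (bigD1 i)//= expr2 lerDl.
by apply: sumr_ge0 => j _; rewrite -expr2 sqr_ge0.
Qed.

Lemma enorm_eq0 x : enorm x = 0 -> x = 0.
Proof.
move=> x0; apply/rowP => i; rewrite mxE; apply/eqP.
by rewrite -normr_le0 -x0 coord_le_enorm.
Qed.

Lemma norm_le_enorm x : `|x| <= enorm x.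
Proof.
have [->|x0] := eqVneq `|x| 0; first by rewrite enorm_ge0.
have [[i j] xij] := mx_norm_neq0 x0.
by apply: (le_trans _ (coord_le_enorm x j)); rewrite -(ord1 i) -xij.
Qed.

Lemma coord_le_norm x (i : 'I_n) : `|x 0 i| <= `|x|.
Proof.
rewrite /Num.norm/= mx_normrE.
exact: (le_bigmax _ (fun ij : 'I_1 * 'I_n => `|x ij.1 ij.2|) (0, i)).
Qed.

(** With [norm_le_enorm] this makes the two norms equivalent, so that estimates in [enorm] yield
    continuity for the sup norm. The constant is cruder than the square root of [n]. *)
Lemma enorm_le_norm x : enorm x <= n%:R * `|x|.
Proof.
rewrite -(ler_pXn2r (n := 2)) ?nnegrE ?enorm_ge0 ?mulr_ge0//.
rewrite sqr_enorm exprMn.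
apply: (@le_trans _ _ (\sum_(i < n) `|x| ^+ 2)).
  apply: ler_sum => i _; rewrite -expr2 -[leLHS]real_normK ?num_real//.
  by rewrite lerXn2r ?nnegrE// coord_le_norm.
rewrite sumr_const card_ord -[leLHS]mulr_natl ler_wpM2r ?sqr_ge0//.
by rewrite -natrX ler_nat; case: (n) => // k; rewrite leq_pmulr.
Qed.

(** Cauchy-Schwarz, by expanding the square of the norm of [enorm y *: x - enorm x *: y]. *)
Lemma dotv_le_enorm x y : dotv x y <= enorm x * enorm y.
Proof.
have [/enorm_eq0 ->|y0] := eqVneq (enorm y) 0.
  by rewrite -[0](scale0r (0 : 'rV[R]_n)) dotvZr mul0r mulr_ge0 ?enorm_ge0.
have [/enorm_eq0 ->|x0] := eqVneq (enorm x) 0.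
  by rewrite -[0](scale0r (0 : 'rV[R]_n)) dotvZl mul0r mulr_ge0 ?enorm_ge0.
have := dotvv_ge0 (enorm y *: x - enorm x *: y).
rewrite !(dotvDl, dotvDr, dotvNl, dotvNr, dotvZl, dotvZr) (dotvC y x) -!sqr_enorm.
have xp : 0 < enorm x by rewrite lt0r x0 enorm_ge0.
have yp : 0 < enorm y by rewrite lt0r y0 enorm_ge0.
move: (enorm x) (enorm y) xp yp (dotv x y) => a b a0 b0 d H.
rewrite -(ler_pM2l (mulr_gt0 a0 b0)); nra.
Qed.

Lemma ler_enormD x y : enorm (x + y) <= enorm x + enorm y.
Proof.
rewrite -(ler_pXn2r (n := 2)) ?nnegrE ?addr_ge0 ?enorm_ge0//.
rewrite sqr_enorm !(dotvDl, dotvDr) (dotvC y x) -!sqr_enorm.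
by have := dotv_le_enorm x y; rewrite sqrrD; lra.
Qed.

(** The square root lies below its tangent at [enorm x ^+ 2]; the right side is that tangent at
    [enorm (x + y) ^+ 2]. *)
Lemma enorm_add_le x y : 0 < enorm x ->
  enorm (x + y) <= enorm x + dotv x y / enorm x + enorm y ^+ 2 / (2 * enorm x).
Proof.
move=> x0; set b := (X in _ <= X).
have : dotv (x + y) (x + y) <= 2 * enorm x * b - enorm x ^+ 2.
  rewrite !(dotvDl, dotvDr) (dotvC y x) -!sqr_enorm /b.
  by rewrite le_eqVlt; apply/orP; left; apply/eqP; field; rewrite gt_eqF.
rewrite -sqr_enorm; have := enorm_ge0 (x + y); clearbody b.
move: (enorm (x + y)) (enorm x) x0 => u a a0 u0 H.
have b0 : 0 < b.
  by rewrite -(pmulr_rgt0 _ (mulr_gt0 (ltr0n R 2) a0)); nra.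
by rewrite -(ler_pXn2r (n := 2)) ?nnegrE ?(ltW b0)//; have := sqr_ge0 (b - a); nra.
Qed.

End euclidean_norm.

(** * Distance to the complement and near points *)

Section distance.
Variables (R : realType) (n : nat) (Omega : set 'rV[R]_n).
Hypothesis proper : ~` Omega !=set0.
Implicit Types (x y z h : 'rV[R]_n).

Lemma delta_le x y : ~ Omega y -> delta Omega x <= enorm (x - y).
Proof.
move=> Oy; apply: ge_inf; last by exists y.
by exists 0 => _ [z _ <-]; exact: enorm_ge0.
Qed.

Lemma delta_ge x (c : R) :
  (forall y, ~ Omega y -> c <= enorm (x - y)) -> c <= delta Omega x.
Proof.
move=> H; apply: lb_le_inf => [|_ [y Oy <-]]; last exact: H.
by have [y Oy] := proper; exists (enorm (x - y)); exists y.
Qed.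

Lemma delta_lipschitz x y : delta Omega x <= delta Omega y + enorm (x - y).
Proof.
rewrite -lerBlDr; apply: delta_ge => z Oz; rewrite lerBlDr.
apply: le_trans (delta_le _ Oz) _; rewrite [leRHS]addrC.
by apply: le_trans (ler_enormD _ _); rewrite addrA subrK.
Qed.

Lemma delta_lipschitz_norm x y :
  `|delta Omega x - delta Omega y| <= n%:R * `|x - y|.
Proof.
apply: le_trans (enorm_le_norm _); rewrite ler_norml.
by have := delta_lipschitz x y; have := delta_lipschitz y x; rewrite enormB; lra.
Qed.

Lemma continuous_delta : continuous (delta Omega).
Proof. exact: (lipschitz_continuous delta_lipschitz_norm). Qed.

Hypothesis openO : open Omega.

Lemma delta_attained x : exists2 y, ~ Omega y & delta Omega x = enorm (x - y).
Proof.
(* The cut-off makes the set compact, and the slack 1 makes it nonempty. *)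
pose A := ~` Omega `&` [set y | enorm (x - y) <= delta Omega x + 1].
have cd : continuous (fun y => enorm (x - y)).
  apply: (@lipschitz_continuous _ _ _ _ n%:R) => y z.
  apply: le_trans (enorm_le_norm _); rewrite ler_norml.
  have := ler_enormD (x - y) (y - z); have := ler_enormD (x - z) (z - y).
  by rewrite !addrA !subrK (enormB z y); lra.
have A0 : A !=set0.
  apply: contrapT => /set0P/negP; rewrite negbK => /eqP A0.
  suff : delta Omega x + 1 <= delta Omega x by rewrite gerDl ler10.
  apply: delta_ge => y Oy; rewrite leNgt; apply/negP => /ltW xy.
  by have : A y by []; rewrite A0.
have cA : compact A.
  apply: bounded_closed_compact.
    exists (`|x| + delta Omega x + 1); split=> [|M ltM y [_ /= Ay]].
      exact: num_real.
    apply: ltW; apply: le_lt_trans ltM; rewrite -addrA.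
    have -> : y = x - (x - y) by rewrite opprB addrCA subrr addr0.
    by rewrite (le_trans (ler_normB _ _))// lerD2l (le_trans (norm_le_enorm _)).
  apply: closedI; first exact: open_closedC.
  apply: (@preimage_closed _ _ _ [set r | r <= delta Omega x + 1]).
    by move=> y _; exact: cd.
  exact: closed_le.
have [y] := EVT_min_rV A0 cA (continuous_subspaceT cd).
rewrite inE => -[Oy Ay] ymin; exists y => //; apply/eqP.
rewrite eq_le delta_le//=; apply: delta_ge => z Oz.
have [Az|/ltW Az] := leP (enorm (x - z)) (delta Omega x + 1).
  by apply: ymin; rewrite inE.
exact: le_trans Ay Az.
Qed.

Lemma delta_gt0 x : Omega x -> 0 < delta Omega x.
Proof.
move=> Ox; have [y Oy ->] := delta_attained x.
rewrite lt0r enorm_ge0 andbT; apply/eqP => /enorm_eq0/eqP.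
by rewrite subr_eq0 => /eqP xy; apply: Oy; rewrite -xy.
Qed.

Lemma near_points_notin x y : near_points Omega x y -> ~ Omega y.
Proof. by move=> [[_ +] _] Oy; apply; rewrite (interior_id _).1. Qed.

(** A nearest point [y] of the complement is a boundary point: points of the segment from [y] to [x]
    that are close to [y] are nearer to [x] than [delta Omega x], hence lie in [Omega]. *)
Lemma near_points_nonempty x : Omega x -> near_points Omega x !=set0.
Proof.
move=> Ox; have [y Oy dxy] := delta_attained x; exists y.
split; last by rewrite dxy enormB.
split; last by rewrite (interior_id _).1.
move=> B /nbhs_ballP[e /= e0 eB].
pose t := e / (e + `|x - y|).
have e'0 : 0 < e + `|x - y| by rewrite ltr_wpDr.
have t0 : 0 < t by rewrite divr_gt0.
have t1 : t <= 1 by rewrite ler_pdivrMr// mul1r lerDl.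
exists (y + t *: (x - y)); split; last first.
  apply: eB; rewrite -ball_normE /ball_/= opprD addNKr normrN normrZ gtr0_norm//.
  by rewrite /t mulrAC ltr_pdivrMr// ltr_pM2l// ltrDr.
apply: contrapT => /(delta_le x).
rewrite (_ : x - _ = (1 - t) *: (x - y)); last first.
  by rewrite scalerBl scale1r opprD addrA.
rewrite enormZ ger0_norm ?subr_ge0// -dxy leNgt => /negP; apply.
by rewrite mulrBl mul1r gtrBl mulr_gt0// delta_gt0.
Qed.

End distance.

(** The bound is required for all [h], not only for small ones. It forces [u] to be the gradient of
    [g] at [x]. *)
Definition quadratic_expansion (R : realType) (n : nat) (g : 'rV[R]_n -> R)
    (c : R) (x u : 'rV[R]_n) : Prop :=
  forall h, `|g (x + h) - g x - dotv u h| <= c * enorm h ^+ 2.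

(** * Quadratic expansion of the distance off the ridge *)

Section ridge_expansion.
Variables (R : realType) (n : nat) (Omega : set 'rV[R]_n).
Hypotheses (proper : ~` Omega !=set0) (openO : open Omega).
Implicit Types (x y z h : 'rV[R]_n).

(** A ridge point on the ray from [y] through [x], if there is one, lies at distance at least [rho]
    beyond [x]. Halving [rho] leaves room to pick an admissible [t] below the supremum. *)
Lemma near_points_extend x y (rho : R) : 0 < rho -> Omega x ->
  near_points Omega x y -> (forall z, ridge Omega z -> rho <= enorm (x - z)) ->
  exists2 t, near_points Omega (y + t *: (x - y)) y &
             rho / 2 <= (t - 1) * delta Omega x.
Proof.
move=> rho0 Ox xy ridgex; have d0 := delta_gt0 proper openO Ox.
have exy : enorm (x - y) = delta Omega x by rewrite enormB; case: xy.
suff /ereal_sup_gt[_ [t [_ tN] <-]] :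
    ((1 + rho / 2 / delta Omega x)%:E < ridge_ratio Omega x y)%E.
  rewrite lte_fin => /ltW tr; exists t => //.
  by rewrite -ler_pdivrMr// lerBrDl.
(* The value [t = 1] is admissible, which excludes [-oo] and settles the sign of [1 - l] below. *)
have r1 : (1%:E <= ridge_ratio Omega x y)%E.
  apply: ereal_sup_ubound; exists 1 => //; split => //.
  by rewrite scale1r addrCA subrr addr0.
case lE : (ridge_ratio Omega x y) r1 => [l|//|//]; last by rewrite ltry.
rewrite lee_fin => l1; rewrite lte_fin.
have := ridgex (y + l *: (x - y)).
rewrite (_ : x - (y + _) = (1 - l) *: (x - y)); last first.
  by rewrite scalerBl scale1r opprD addrA.
rewrite enormZ exy ler0_norm ?subr_le0// opprB -ler_pdivrMr// => H.
have {}H : rho / delta Omega x <= l - 1 by apply: H; exists x, y, l; split.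
rewrite -ltrBrDl (lt_le_trans _ H)// ltr_pM2r ?invr_gt0//; lra.
Qed.

(* The upper bound compares delta with the distance to the near point y, the
   lower bound with the distance to a centre further along the ray from y. *)
Lemma delta_quadratic_expansion x (rho : R) : 0 < rho -> rho <= delta Omega x ->
  Omega x -> (forall z, ridge Omega z -> rho <= enorm (x - z)) ->
  exists2 u, enorm u = 1 & quadratic_expansion (delta Omega) rho^-1 x u.
Proof.
move=> rho0 rhod Ox ridgex.
have [y xy] := near_points_nonempty proper openO Ox.
have [t ty tr] := near_points_extend rho0 Ox xy ridgex.
have d0 : 0 < delta Omega x := lt_le_trans rho0 rhod.
have exy : enorm (x - y) = delta Omega x by rewrite enormB; case: xy.
have Oy := near_points_notin openO xy.
set d := delta Omega x in rhod tr d0 exy *.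
have t1 : 0 < t - 1 by rewrite -(pmulr_lgt0 _ d0); lra.
exists (d^-1 *: (x - y)).
  by rewrite enormZ exy gtr0_norm ?invr_gt0// mulVf ?gt_eqF.
move=> h; rewrite dotvZl -/d.
have hh : 0 <= enorm h ^+ 2 by exact: sqr_ge0.
have inv_le a b : 0 < a -> a <= b -> enorm h ^+ 2 / b <= a^-1 * enorm h ^+ 2.
  move=> a0 ab; rewrite mulrC ler_wpM2r// lef_pV2 ?posrE//.
  exact: lt_le_trans ab.
have up :
    delta Omega (x + h) <= d + d^-1 * dotv (x - y) h + rho^-1 * enorm h ^+ 2.
  apply: le_trans (delta_le _ Oy) _; rewrite addrAC.
  apply: (le_trans (enorm_add_le _ _)); rewrite exy//.
  rewrite (mulrC d^-1) lerD2l; apply: inv_le => //; lra.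
have zx : y + t *: (x - y) - (x + h) = (t - 1) *: (x - y) + - h.
  by rewrite scalerBl scale1r; apply/rowP => i; rewrite !mxE; ring.
have e1 : enorm ((t - 1) *: (x - y)) = (t - 1) * d.
  by rewrite enormZ exy gtr0_norm.
(* [y] is also a near point of the farther centre. *)
have dz : delta Omega (y + t *: (x - y)) = t * d.
  case: ty => _ <-; rewrite opprD addrA subrr add0r enormN enormZ exy gtr0_norm//.
  lra.
have lo := delta_lipschitz proper (y + t *: (x - y)) (x + h).
have := @enorm_add_le _ _ ((t - 1) *: (x - y)) (- h).
rewrite dz zx in lo; rewrite e1 mulr_gt0// => /(_ isT) lo'.
have lo2 := le_trans lo (lerD (lexx _) lo').
have td : (t - 1) * d != 0 by rewrite gt_eqF// mulr_gt0.
have q' : dotv ((t - 1) *: (x - y)) (- h) / ((t - 1) * d)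
    = - (dotv (x - y) h / d).
  by rewrite dotvZl dotvNr; field; rewrite !gt_eqF.
rewrite q' enormN in lo2.
(* [(t - 1) * d] is at least [rho / 2], which the factor 2 in the denominator compensates. *)
have : enorm h ^+ 2 / (2 * ((t - 1) * d)) <= rho^-1 * enorm h ^+ 2.
  by apply: inv_le => //; lra.
rewrite (mulrC d^-1) in up *; move: up lo2.
set q := dotv _ _ / d; rewrite ler_norml; lra.
Qed.

End ridge_expansion.

Section expansion.
Variables (R : realType) (n : nat) (g : 'rV[R]_n -> R) (c : R).
Implicit Types (x u h : 'rV[R]_n).

(** The difference quotient with step [h] deviates from [u 0 i] by at most [c * |h|]. *)
Lemma quadratic_expansion_is_derive x u (i : 'I_n) :
  quadratic_expansion g c x u -> is_derive x (unitv i) g (u 0 i).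
Proof.
move=> gxu.
have lim : h^-1 *: ((g \o shift x) (h *: unitv i) - g x) @[h --> 0^'] --> u 0 i.
  apply/cvgrPdist_le => e e0.
  have c0 : 0 < `|c| + 1 by rewrite ltr_wpDl.
  near=> h.
  have h0 : h != 0 by near: h; exact: nbhs_dnbhs_neq.
  have he : `|h| < e / (`|c| + 1) by near: h; apply: dnbhs0_lt; rewrite divr_gt0.
  have := gxu (h *: unitv i).
  rewrite dotvZr dotv_unitv enormZ enorm_unitv mulr1 [x + _]addrC /=.
  move: (g _ - g x) => d dh.
  rewrite (_ : u 0 i - _ = - (h^-1 * (d - h * u 0 i))); last first.
    by rewrite /GRing.scale/= mulrBr mulKf// opprB.
  rewrite normrN normrM normfV ler_pdivrMl ?normr_gt0// (le_trans dh)//.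
  rewrite expr2 mulrA [leRHS]mulrC ler_wpM2r// (le_trans (ler_norm _))//.
  rewrite normrM normr_id; move: he; rewrite ltr_pdivlMr// => he.
  by apply: le_trans (ltW he); rewrite mulrC ler_wpM2l// lerDl.
split; first by apply/cvg_ex; exists (u 0 i).
exact: cvg_lim lim.
Unshelve. all: by end_near. Qed.

Lemma quadratic_expansion_grad x u :
  quadratic_expansion g c x u -> grad g x = u.
Proof.
move=> /quadratic_expansion_is_derive gxu; apply/rowP => i; rewrite mxE.
by rewrite /partial derive_val.
Qed.

(* Both expansions are evaluated at y + k, where k is parallel to the i-th axis
   and has length enorm (x - y). *)
Lemma quadratic_expansion_lipschitz x y u w (i : 'I_n) :
  quadratic_expansion g c x u -> quadratic_expansion g c y w ->
  `|u 0 i - w 0 i| <= 6 * c * enorm (x - y).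
Proof.
move=> xu yw; pose h := y - x; pose e := enorm h.
have [/enorm_eq0 h0|e0] := eqVneq e 0.
  have yx : y = x by rewrite -(subrK x y) -/h h0 add0r.
  move: yw; rewrite yx => /quadratic_expansion_grad <-.
  move: xu => /quadratic_expansion_grad <-.
  by rewrite !subrr normr0 enorm0 mulr0.
have {}e0 : 0 < e by rewrite lt0r e0 enorm_ge0.
rewrite (enormB x).
have c0 : 0 <= c.
  have := le_trans (normr_ge0 _) (xu h).
  by rewrite pmulr_lge0// exprn_gt0.
(* The remainders at [h + k], [h] and [k] are at most [c * e ^+ 2] times 4, 1 and 1, whence the
   factor 6. The sign [s] of [k] gives both halves of the absolute value. *)
have sgn s : `|s| = 1 -> s * (u 0 i - w 0 i) <= 6 * c * e.
  move=> s1; pose k := (s * e) *: (unitv i : 'rV[R]_n).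
  have kE : enorm k = e.
    by rewrite enormZ enorm_unitv normrM s1 mulr1 mul1r gtr0_norm.
  have := xu (h + k); have := xu h; have := yw k.
  rewrite (addrA x h k) (_ : x + h = y); last by rewrite addrC subrK.
  rewrite kE -/e.
  have hk : c * enorm (h + k) ^+ 2 <= c * (2 * e) ^+ 2.
    rewrite ler_wpM2l// lerXn2r ?nnegrE ?enorm_ge0 ?mulr_ge0 ?(ltW e0)//.
    by rewrite (le_trans (ler_enormD _ _))// kE -/e; lra.
  rewrite dotvDr !(dotvZr _ _ (unitv i)) !dotv_unitv => /ler_normlP[_ k1].
  move=> /ler_normlP[_ h1] /ler_normlP[hk1 _]; have {}hk1 := le_trans hk1 hk.
  rewrite -(ler_pM2l e0); nra.
by apply/ler_normlP; split; [rewrite -mulN1r|rewrite -[leLHS]mul1r];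
  apply: sgn; rewrite ?normrN1 ?normr1.
Qed.

End expansion.

(** [delta_quadratic_expansion] made uniform by compactness: one [e] serves as radius of the
    neighbourhood, lower bound of the distance and inverse of the curvature bound. *)
Lemma compact_delta_expansion (R : realType) (n : nat) (Omega K : set 'rV[R]_n) :
  ~` Omega !=set0 -> open Omega -> closed_relative Omega (ridge Omega) ->
  compact K -> K `<=` Omega `\` ridge Omega ->
  exists2 e : R, 0 < e & forall x y, K x -> enorm (x - y) < e ->
    [/\ e <= delta Omega y, enorm (grad (delta Omega) y) = 1 &
        quadratic_expansion (delta Omega) e^-1 y (grad (delta Omega) y)].
Proof.
move=> proper openO rel cK KO.
(* The distance to the complement of V is positive and continuous on K, and it
   bounds both delta and the distance to the ridge from below. *)
pose V := Omega `\` closure (ridge Omega).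
have openV : open V.
  by rewrite /V setDE; apply: openI => //; exact/closed_openC/closed_closure.
have notV : ~` V !=set0 by have [y Oy] := proper; exists y => -[].
have KV : K `<=` V.
  by move=> x /KO[Ox rx]; split=> // cx; apply: rx; exact: rel.
have [m m0 mK] : exists2 m : R, 0 < m & forall x, K x -> m <= delta V x.
  have [->|/set0P K0] := eqVneq K set0; first by exists 1.
  have [x xK xmin] := EVT_min_rV K0 cK
    (continuous_subspaceT (continuous_delta notV)).
  exists (delta V x); first by apply: delta_gt0 => //; apply: KV; rewrite -inE.
  by move=> y Ky; apply: xmin; rewrite inE.
exists (m / 2); first by rewrite divr_gt0.
move=> x y Kx xy.
have Vy : m / 2 <= delta V y.
  by have := mK _ Kx; have := delta_lipschitz notV x y; lra.
have e0 : 0 < m / 2 by rewrite divr_gt0.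
have inV z : enorm (y - z) < m / 2 -> V z.
  by move=> yz; apply: contrapT => /(delta_le y); lra.
have Oy : Omega y by have [] := inV y; rewrite ?subrr ?enorm0.
have dy : m / 2 <= delta Omega y.
  apply: delta_ge => // z Oz; rewrite leNgt; apply/negP => /inV[].
  by move=> Oz2 _; exact: Oz.
have ry z : ridge Omega z -> m / 2 <= enorm (y - z).
  by move=> rz; rewrite leNgt; apply/negP => /inV[_]; apply; exact: subset_closure.
have [u u1 yu] := delta_quadratic_expansion proper openO e0 dy Oy ry.
by rewrite (quadratic_expansion_grad yu).
Qed.

(** * Derivatives along lines *)

Section directional.
Variables (R : realType) (V : normedModType R).
Implicit Types (g : V -> R) (x v : V).

(** The difference quotients coincide; theorems in one variable thus transfer to directional
    derivatives. *)
Lemma is_derive_line g x v (t l : R) :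
  is_derive t 1 (fun s => g (s *: v + x)) l <-> is_derive (t *: v + x) v g l.
Proof.
have E : (fun h : R => h^-1 *: (((fun s => g (s *: v + x)) \o shift t) (h *: 1)
      - g (t *: v + x)))
    = (fun h : R => h^-1 *: ((g \o shift (t *: v + x)) (h *: v) - g (t *: v + x))).
  by apply/funext => h /=; rewrite [h *: 1]mulr1 scalerDl addrA.
by split=> -[dg lE]; split; move: dg lE; rewrite /derivable /derive E.
Qed.

(** The one-variable chain rule along a line, so that [g] needs a derivative in the direction [v]
    alone. *)
Lemma is_derive_comp1 g (F : R -> R) x v (l l' : R) :
  is_derive x v g l -> is_derive (g x) 1 F l' -> is_derive x v (F \o g) (l' * l).
Proof.
move=> gl Fl'.
have x0 : x = 0 *: v + x by rewrite scale0r add0r.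
have gl0 : is_derive (0 : R) 1 (fun s => g (s *: v + x)) l.
  by apply/is_derive_line; rewrite -x0.
rewrite x0; apply/(is_derive_line (F \o g)).
apply: (@is_derive1_comp _ F (fun s => g (s *: v + x))) => //.
by rewrite -x0.
Qed.

(** The mean value theorem on the segment, with its end points taken in increasing order. *)
Lemma is_derive_le_lipschitz g x v (h C : R) (l : R -> R) :
  (forall s, `|s| <= `|h| -> is_derive (s *: v + x) v g (l s)) ->
  (forall s, `|s| <= `|h| -> `|l s| <= C) ->
  `|g (h *: v + x) - g x| <= C * `|h|.
Proof.
move=> gl lC; pose G s := g (s *: v + x).
have dG (s : R) : `|s| <= `|h| -> is_derive s 1 G (l s).
  by move=> /gl ?; apply/is_derive_line.
have cG (a b : R) : `|a| <= `|h| -> `|b| <= `|h| ->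
    {within `[a, b], continuous G}.
  move=> ah bh; apply: derivable_within_continuous => s.
  rewrite in_itv/= => /andP[as_ sb].
  have /dG : `|s| <= `|h|.
    move: ah bh => /ler_normlP[? ?] /ler_normlP[? ?].
    by apply/ler_normlP; split; lra.
  by case.
have h0 : `|0 : R| <= `|h| by rewrite normr0.
rewrite (_ : g x = G 0); last by rewrite /G scale0r add0r.
rewrite -/(G h).
have key (a b : R) : a <= b -> `|a| <= `|h| -> `|b| <= `|h| ->
    `|G b - G a| <= C * `|b - a|.
  move=> ab ah bh.
  have [|c cab ->] := @MVT_segment R G l a b ab _ (cG a b ah bh).
    move=> s; rewrite in_itv/= => /andP[as_ sb]; apply: dG.
    move: ah bh => /ler_normlP[? ?] /ler_normlP[? ?].
    by apply/ler_normlP; split; lra.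
  rewrite normrM ler_wpM2r// lC//.
  move: cab; rewrite in_itv/= => /andP[as_ sb].
  move: ah bh => /ler_normlP[? ?] /ler_normlP[? ?].
  by apply/ler_normlP; split; lra.
have [h0'|h0'] := leP 0 h.
  by rewrite -[in leRHS](subr0 h); apply: key.
by rewrite distrC -(normrN h) -(sub0r h); apply: key => //; exact: ltW.
Qed.

End directional.

(** * Powers of the absolute value and Young's inequality *)

Section norm_power.
Variables (R : realType) (p : R).
Hypothesis p1 : 1 < p.

Lemma is_derive_norm_power (s : R) :
  is_derive s 1 (fun s : R => `|s| `^ p) (p * Num.sg s * `|s| `^ (p - 1)).
Proof.
have [s0|s0|->] := ltrgtP s 0.
- have := is_derive_comp1 (is_deriveN (is_derive_id s 1))
    (is_derive1_powR p (_ : 0 < - s)).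
  rewrite oppr_gt0 => /(_ s0); rewrite ltr0_sg// ltr0_norm// mulrN1 mulrN mulr1.
  rewrite mulNr; apply: near_eq_is_derive; near=> t.
  by rewrite ltr0_norm//; near: t; exact: lt_nbhsl.
- have := is_derive1_powR p s0; rewrite gtr0_sg// gtr0_norm// mulr1.
  apply: near_eq_is_derive; near=> t.
  by rewrite gtr0_norm//; near: t; exact: lt_nbhsr.
- rewrite sgr0 mulr0 mul0r.
  have lim : h^-1 *: (`|h *: (1 : R) + 0| `^ p - `|0 : R| `^ p)
      @[h --> (0 : R)^'] --> (0 : R).
    apply/cvgrPdist_le => e e0; near=> h.
    have h0 : h != 0 by near: h; exact: nbhs_dnbhs_neq.
    have p10 : 0 < p - 1 by rewrite subr_gt0.
    have he : `|h| <= e `^ (p - 1)^-1.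
      apply: ltW; near: h; apply: dnbhs0_lt; exact: powR_gt0.
    rewrite sub0r normrN normr0 powR0 ?subr0 ?addr0 ?(gt_eqF (lt_trans ltr01 p1))//.
    rewrite [h *: 1]mulr1 normrM normfV (ger0_norm (powR_ge0 _ _)).
    rewrite -(mulr_powRB1 (normr_ge0 h) (lt_trans ltr01 p1)).
    rewrite mulKf ?normr_eq0//.
    have := ge0_ler_powR (ltW p10) _ _ he.
    rewrite !nnegrE powR_ge0 normr_ge0 -powRrM mulVf ?gt_eqF// powRr1 ?(ltW e0)//.
    exact.
  split; first by apply/cvg_ex; exists 0.
  exact: cvg_lim lim.
Unshelve. all: by end_near. Qed.
Lemma young_power (X Y : R) : 0 <= X -> 0 <= Y ->
  p * X `^ (p - 1) * Y <= (p - 1) * X `^ p + Y `^ p.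
Proof.
move=> X0 Y0; have p10 : 0 < p - 1 by rewrite subr_gt0.
have p0 : 0 < p := lt_trans ltr01 p1.
have := @conjugate_powR R Y (X `^ (p - 1)) p (p / (p - 1)) Y0 (powR_ge0 _ _) p0.
rewrite divr_gt0// => /(_ isT); rewrite -powRrM invf_div.
have -> : p^-1 + (p - 1) / p = 1 by field; rewrite gt_eqF.
have -> : (p - 1) * (p / (p - 1)) = p by field; rewrite gt_eqF.
move=> /(_ erefl); rewrite -(ler_pM2l p0) => H.
rewrite (_ : p * X `^ _ * Y = p * (Y * X `^ (p - 1))); last by ring.
apply: (le_trans H); rewrite le_eqVlt; apply/orP; left; apply/eqP.
by field; rewrite gt_eqF.
Qed.

End norm_power.

Lemma is_derive_continuous (R : realType) (V : normedModType R) (F : R -> V)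
    (s : R) (l : V) : is_derive s 1 F l -> {for s, continuous F}.
Proof.
by move=> [dF _]; apply: differentiable_continuous; apply/derivable1_diffP.
Qed.

(** Both functions vanish at [x], so the quotients of [g] are dominated by those of [a]. This
    differentiates the field at zeros of [f], where second derivatives of the distance may fail to
    exist. *)
Lemma is_derive_sandwich (R : realType) (V : normedModType R) (g a : V -> R)
    (C : R) (x v : V) :
  (forall y, `|g y| <= C * `|a y|) -> a x = 0 -> is_derive x v a 0 ->
  is_derive x v g 0.
Proof.
move=> ga ax0 [da a0].
have gx0 : g x = 0.
  by apply/eqP; rewrite -normr_le0 (le_trans (ga x))// ax0 normr0 mulr0.
have lima : h^-1 *: ((a \o shift x) (h *: v) - a x) @[h --> 0^'] --> 'D_v a x.
  exact: da.
rewrite {}a0 in lima.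
have lim : h^-1 *: ((g \o shift x) (h *: v) - g x) @[h --> 0^'] --> (0 : R).
  apply/cvgrPdist_le => e e0.
  have C0 : 0 < `|C| + 1 by rewrite ltr_wpDl.
  near=> h.
  have : `|0 - h^-1 *: ((a \o shift x) (h *: v) - a x)| <= e / (`|C| + 1).
    by near: h; apply: cvgr_dist_le; [exact: lima|rewrite divr_gt0].
  rewrite /= gx0 ax0 !subr0 !sub0r !normrN !normrM => H.
  apply: (@le_trans _ _ ((`|C| + 1) * (`|h^-1| * `|a (h *: v + x)|))).
    rewrite mulrCA ler_wpM2l// (le_trans (ga _))// ler_wpM2r//.
    by rewrite (le_trans (ler_norm _))// lerDl.
  by rewrite mulrC -ler_pdivlMr.
split; first by apply/cvg_ex; exists 0.
exact: cvg_lim lim.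
Unshelve. all: by end_near. Qed.

Lemma ge0_ger_powRN (R : realType) (q a b : R) :
  0 <= q -> 0 < a -> a <= b -> b `^ (- q) <= a `^ (- q).
Proof.
move=> q0 a0 ab; have b0 := lt_le_trans a0 ab.
rewrite !powRN lef_pV2 ?posrE ?powR_gt0//.
by apply: ge0_ler_powR; rewrite ?nnegrE// ltW.
Qed.

(** * The weighted vector field and its divergence *)

Lemma integral_sum (d : measure_display) (T : measurableType d) (R : realType)
    (mu : {measure set T -> \bar R}) (I : Type) (r : seq I) (h : I -> T -> R) :
  (forall i, mu.-integrable setT (EFin \o h i)) ->
  mu.-integrable setT (fun x => (\sum_(i <- r) h i x)%:E) /\
  (\int[mu]_x (\sum_(i <- r) h i x)%:E
   = \sum_(i <- r) \int[mu]_x (h i x)%:E)%E.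
Proof.
move=> ih; elim: r => [|i r [IH1 IH2]].
  rewrite big_nil; under eq_fun do rewrite big_nil.
  by split; [exact: integrable0|exact: integral0].
rewrite big_cons -IH2; under eq_fun do rewrite big_cons EFinD.
by split; [exact: integrableD (ih i) IH1|exact: integralD (ih i) IH1].
Qed.

Lemma compact_coord_bound (R : realType) (n : nat) (K : set 'rV[R]_n) :
  compact K -> exists M : R, forall (x : 'rV[R]_n) k, M <= `|x 0 k| -> ~ K x.
Proof.
move=> /compact_bounded[M [_ KM]]; exists (M + 1) => x k Mx Kx.
have := KM (M + 2^-1) _ x Kx; rewrite ltrDl invr_gt0 => /(_ (ltr0n R 2)).
by have := coord_le_norm x k; rewrite /=; lra.
Qed.

Lemma near_closed_support (R : realType) (n : nat) (K : set 'rV[R]_n)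
    (f : 'rV[R]_n -> R) (x : 'rV[R]_n) :
  closed K -> (forall y, f y != 0 -> K y) -> ~ K x ->
  \forall y \near x, f y = 0.
Proof.
move=> closedK f0 Kx; have : nbhs x (~` K).
  by apply: open_nbhs_nbhs; split => //; exact: closed_openC.
apply: filterS => y Ky; apply/eqP/negPn/negP => /f0; exact: Ky.
Qed.

Lemma partial_eq0 (R : realType) (n : nat) (K : set 'rV[R]_n)
    (f : 'rV[R]_n -> R) (i : 'I_n) (x : 'rV[R]_n) :
  closed K -> (forall y, f y != 0 -> K y) -> ~ K x -> partial i f x = 0.
Proof.
move=> closedK f0 Kx; rewrite /partial (near_eq_derive _ (g := cst 0)).
  exact: derive_cst.
exact: near_closed_support closedK f0 Kx.
Qed.

(** * The field for a function [d] with uniform quadratic expansions near [K] *)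

Section weighted_gradient.
Variables (R : realType) (n : nat) (K : set 'rV[R]_n) (d f : 'rV[R]_n -> R).
Variables (e A B p : R).
Hypotheses (e0 : 0 < e) (p1 : 1 < p) (A0 : 0 <= A) (B0 : 0 <= B).
Hypothesis dK : forall x y, K x -> enorm (x - y) < e ->
  [/\ e <= d y, enorm (grad d y) = 1 & quadratic_expansion d e^-1 y (grad d y)].
Hypotheses (cd : continuous d) (cf : continuous f).
Hypothesis df : forall i x, derivable f x (unitv i).
Hypothesis fA : forall x, `|f x| <= A.
Hypothesis fB : forall i x, `|partial i f x| <= B.
Hypotheses (closedK : closed K) (f0 : forall x, f x != 0 -> K x).
Implicit Types (x y : 'rV[R]_n) (i : 'I_n).

Let a x := `|f x| `^ p.
Definition weight x := a x * d x `^ (1 - p).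
Local Notation w := weight.
(* The i-th partial derivative of weight. *)
Definition weight' i x := p * Num.sg (f x) * `|f x| `^ (p - 1) * partial i f x
  * d x `^ (1 - p) + a x * ((1 - p) * d x `^ (- p) * partial i d x).
Local Notation w' := weight'.
(** The [i]-th component of the vector field. *)
Let G i x := w x * partial i d x.

Let p0 : 0 < p. Proof. exact: lt_trans p1. Qed.

Let f_is_derive i x : is_derive x (unitv i) f (partial i f x).
Proof. exact: derivableP. Qed.

Let a_is_derive i x : is_derive x (unitv i) a
  (p * Num.sg (f x) * `|f x| `^ (p - 1) * partial i f x).
Proof. exact: is_derive_comp1 (is_derive_norm_power p1 (f x)). Qed.

Let continuous_a : continuous a.
Proof.
move=> x; apply: (@continuous_comp _ _ _ f (fun s => `|s| `^ p)).
  exact: cf.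
exact: is_derive_continuous (is_derive_norm_power p1 _).
Qed.

Let d_is_derive i x y : K x -> enorm (x - y) < e ->
  is_derive y (unitv i) d (partial i d y).
Proof.
move=> Kx xy; have [_ _ /quadratic_expansion_is_derive] := dK Kx xy.
by move=> /(_ i); rewrite mxE.
Qed.

Let KK x : K x -> enorm (x - x) < e.
Proof. by rewrite subrr enorm0. Qed.

Let d_gt0 x y : K x -> enorm (x - y) < e -> 0 < d y.
Proof. by move=> Kx xy; have [+ _ _] := dK Kx xy; exact: lt_le_trans. Qed.

Let partial_d_le1 i x y : K x -> enorm (x - y) < e -> `|partial i d y| <= 1.
Proof.
move=> Kx xy; have [_ <- _] := dK Kx xy.
by have := coord_le_enorm (grad d y) i; rewrite mxE.
Qed.

Let w_is_derive i x y : K x -> enorm (x - y) < e ->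
  is_derive y (unitv i) w (w' i y).
Proof.
move=> Kx xy; have dd := d_is_derive i Kx xy.
have := is_derive_comp1 dd (is_derive1_powR (1 - p) (d_gt0 Kx xy)).
move=> /(is_deriveM (a_is_derive i y)) wy; apply: (is_derive_eq wy).
rewrite /w' /GRing.scale/= (_ : 1 - p - 1 = - p); last by ring.
by rewrite addrC; congr (_ + _); rewrite mulrC.
Qed.

Let a_ge0 x : 0 <= a x. Proof. exact: powR_ge0. Qed.

Let a_le x : a x <= A `^ p.
Proof. by apply: ge0_ler_powR; rewrite ?nnegrE// ltW. Qed.

Let w_le x y : K x -> enorm (x - y) < e -> `|w y| <= A `^ p * e `^ (1 - p).
Proof.
move=> Kx xy; have [ed _ _] := dK Kx xy.
rewrite normrM !ger0_norm ?powR_ge0// ler_pM ?powR_ge0//.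
by rewrite -opprB ge0_ger_powRN// subr_ge0 ltW.
Qed.

(** Bounds [w'] near [K]: there [d] is at least [e], so its negative powers are at most those of
    [e], and its partial derivatives are at most 1 in modulus. *)
Let C' := p * A `^ (p - 1) * B * e `^ (1 - p) + A `^ p * ((p - 1) * e `^ (- p)).

Let w'_le i x y : K x -> enorm (x - y) < e -> `|w' i y| <= C'.
Proof.
move=> Kx xy; have [ed _ _] := dK Kx xy.
rewrite (le_trans (ler_normD _ _))// lerD// !normrM.
  rewrite !(ger0_norm (powR_ge0 _ _)) (gtr0_norm p0).
  rewrite ler_pM ?powR_ge0 ?mulr_ge0 ?powR_ge0 ?(ltW p0)//.
    rewrite ler_pM ?powR_ge0 ?mulr_ge0 ?powR_ge0 ?(ltW p0)//.
    rewrite ler_pM ?powR_ge0 ?mulr_ge0 ?(ltW p0)//.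
      by rewrite -[leRHS]mulr1 ler_wpM2l ?(ltW p0)// normr_sg lern1 leq_b1.
    by apply: ge0_ler_powR; rewrite ?nnegrE ?subr_ge0 ?(ltW p1).
  by rewrite -opprB ge0_ger_powRN// subr_ge0 ltW.
have q1 : `|1 - p| <= p - 1 by rewrite ler0_norm ?opprB// subr_le0 ltW.
have q2 : `|d y `^ (- p)| <= e `^ (- p).
  by rewrite ger0_norm ?powR_ge0// ge0_ger_powRN// ltW.
have q3 : `|a y| <= A `^ p by rewrite ger0_norm.
rewrite ler_pM ?mulr_ge0// -[leRHS]mulr1.
by rewrite ler_pM ?mulr_ge0 ?ler_pM ?(partial_d_le1 _ Kx).
Qed.

Let Cw := A `^ p * e `^ (1 - p).

Let Cw0 : 0 <= Cw. Proof. by rewrite mulr_ge0 ?powR_ge0. Qed.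

Let w0 x : f x = 0 -> w x = 0.
Proof. by move=> fx; rewrite /w /a fx normr0 powR0 ?mul0r// gt_eqF. Qed.

Let w'0 i x : f x = 0 -> w' i x = 0.
Proof.
move=> fx; rewrite /w' /a fx sgr0 normr0 (powR0 (x := p)) ?gt_eqF//.
by rewrite mulr0 !mul0r addr0.
Qed.

Let G_le_norm i x : `|G i x| <= `|w x|.
Proof.
have [fx|/f0 Kx] := eqVneq (f x) 0; first by rewrite /G w0// mul0r.
by rewrite normrM ler_piMr// (partial_d_le1 _ Kx)// KK.
Qed.

Let G_le i x : `|G i x| <= Cw.
Proof.
have [fx|/f0 Kx] := eqVneq (f x) 0; first by rewrite /G w0// mul0r normr0.
exact: le_trans (G_le_norm i x) (w_le Kx (KK Kx)).
Qed.

Let partial_d_lipschitz i x y : K x -> enorm (x - y) < e ->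
  `|partial i d x - partial i d y| <= 6 * e^-1 * enorm (x - y).
Proof.
move=> Kx xy; have [_ _ dx] := dK Kx (KK Kx); have [_ _ dy] := dK Kx xy.
by have := quadratic_expansion_lipschitz i dx dy; rewrite !mxE.
Qed.

Let L1 := Cw * (6 * e^-1) + C'.

(** The increment of the product splits in two: the quadratic expansions control that of
    [partial i d], the mean value theorem that of [w]. *)
Let G_lipschitz_near i x (h : R) : K x -> `|h| < e ->
  `|G i (h *: unitv i + x) - G i x| <= L1 * `|h|.
Proof.
move=> Kx he; set y := h *: unitv i + x.
have xsE (s : R) : enorm (x - (s *: unitv i + x)) = `|s|.
  by rewrite opprD addrCA subrr addr0 enormN enormZ enorm_unitv mulr1.
have xy : enorm (x - y) < e by rewrite xsE.
have wL : `|w y - w x| <= C' * `|h|.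
  apply: (@is_derive_le_lipschitz _ _ w x (unitv i) h C'
    (fun s => w' i (s *: unitv i + x))) => s sh.
    by apply: w_is_derive Kx _; rewrite xsE; exact: le_lt_trans he.
  by apply: w'_le Kx _; rewrite xsE; exact: le_lt_trans he.
rewrite (_ : G i y - G i x = w y * (partial i d y - partial i d x)
    + (w y - w x) * partial i d x); last by rewrite /G; ring.
rewrite (le_trans (ler_normD _ _))// /L1 [leRHS]mulrDl lerD// normrM.
  rewrite -mulrA ler_pM ?(w_le Kx)// distrC.
  by have := partial_d_lipschitz i Kx xy; rewrite xsE.
by rewrite -[leRHS]mulr1 ler_pM ?(partial_d_le1 _ Kx) ?KK.
Qed.

(** [L1] serves short steps, [2 * Cw / e] serves steps of length at least [e], and the summand 1
    makes [L] positive. *)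
Let L := L1 + 2 * Cw / e + 1.

Let C'0 : 0 <= C'.
Proof.
have p10 : 0 <= p - 1 by rewrite subr_ge0 ltW.
by rewrite addr_ge0// !mulr_ge0 ?powR_ge0// ltW.
Qed.

Let L1_ge0 : 0 <= L1.
Proof. by rewrite addr_ge0// mulr_ge0// mulr_ge0// invr_ge0 ltW. Qed.

Let Cwe0 : 0 <= 2 * Cw / e.
Proof. by apply: divr_ge0; [exact: mulr_ge0|exact: ltW]. Qed.

(** For a short step, if [f] vanishes at [x] but not at the other end, the local estimate is applied
    from that end with the step [- h]. *)
Let G_lipschitz i x (h : R) : `|G i (h *: unitv i + x) - G i x| <= L * `|h|.
Proof.
have [he|he] := leP e `|h|.
  apply: (@le_trans _ _ (2 * Cw / e * `|h|)); last first.
    by rewrite ler_wpM2r// /L; have := L1_ge0; lra.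
  apply: (@le_trans _ _ (Cw + Cw)).
    by rewrite (le_trans (ler_normB _ _))// lerD.
  by rewrite mulrAC ler_pdivlMr//; have := ler_wpM2l Cw0 he; lra.
apply: (@le_trans _ _ (L1 * `|h|)).
  have [fx|/f0 Kx] := eqVneq (f x) 0; last exact: G_lipschitz_near.
  have [fy|/f0 Ky] := eqVneq (f (h *: unitv i + x)) 0.
    by rewrite /G !w0// !mul0r subrr normr0 mulr_ge0.
  have := @G_lipschitz_near i _ (- h) Ky.
  by rewrite normrN scaleNr addKr distrC; exact.
by rewrite ler_wpM2r// /L; have := Cwe0; lra.
Qed.

Let near_notK x : ~ K x -> \forall y \near x, f y = 0.
Proof. exact: near_closed_support. Qed.

Let continuous_G i : continuous (G i).
Proof.
move=> x; have [Kx|/near_notK Kx] := pselect (K x); last first.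
  have Gx y : f y = 0 -> G i y = 0 by move=> fy; rewrite /G w0 ?mul0r.
  apply: (@near_lipschitz_continuous R _ _ (G i) 0).
  have fx := nbhs_singleton Kx.
  by apply: filterS Kx => y fy; rewrite !Gx ?subrr ?normr0 ?mul0r.
have cb : d y `^ (1 - p) @[y --> x] --> d x `^ (1 - p).
  apply: (cvg_comp d (fun s => s `^ (1 - p))); first exact: cd.
  exact: is_derive_continuous (is_derive1_powR _ (d_gt0 Kx (KK Kx))).
suff : {for x, continuous (partial i d)}.
  exact: (cvgM (cvgM (@continuous_a x) cb)).
apply: (@near_lipschitz_continuous R _ _ (partial i d)
  (6 * e^-1 * n%:R)).
(* This radius in the sup norm keeps [enorm (x - y)] below [e]. *)
apply/nbhs_ballP; exists (e / (n%:R + 1)) => /=.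
  by rewrite divr_gt0// ltr_wpDl.
move=> y; rewrite -ball_normE /= ltr_pdivlMr ?ltr_wpDl// => xy.
have nxy := enorm_le_norm (x - y).
have xye : enorm (x - y) < e.
  by have := normr_ge0 (x - y); lra.
rewrite (le_trans (partial_d_lipschitz i Kx xye))//.
by rewrite -[leRHS]mulrA ler_wpM2l// mulr_ge0// invr_ge0 ltW.
Qed.

(* The i-th partial derivative of the field, wherever it exists; elsewhere it
   carries the default value of the second derivative that also occurs in
   laplacian d, so that the pointwise inequality below holds everywhere. *)
Definition weight_derive i x :=
  w x * partial i (partial i d) x + w' i x * partial i d x.
Local Notation D := weight_derive.

(** [G i] is dominated by a multiple of [a], whose derivative vanishes at zeros of [f] since
    [p > 1]. *)
Let G_derive0 i x : f x = 0 -> is_derive x (unitv i) (G i) 0.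
Proof.
move=> fx; apply: (@is_derive_sandwich _ _ (G i) a (e `^ (1 - p))).
- move=> y; have [fy|/f0 Ky] := eqVneq (f y) 0.
    by rewrite /G w0// mul0r normr0 mulr_ge0 ?powR_ge0.
  rewrite (le_trans (G_le_norm i y))// /w normrM mulrC ler_wpM2r//.
  have [ed _ _] := dK Ky (KK Ky).
  by rewrite ger0_norm ?powR_ge0// -opprB ge0_ger_powRN// subr_ge0 ltW.
- by rewrite /a fx normr0 powR0// gt_eqF.
- have := a_is_derive i x; rewrite fx sgr0 mulr0 !mul0r; exact.
Qed.

Let w_neq0 x : f x != 0 -> w x != 0.
Proof.
move=> fx; have Kx := f0 fx.
by rewrite gt_eqF// mulr_gt0 ?powR_gt0 ?normr_gt0// (d_gt0 Kx (KK Kx)).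
Qed.

(** Near [x] the weight is nonzero, and it is derivable at [x], so one passes between the two
    functions by multiplying or dividing by it. *)
Let derivable_G i x : f x != 0 ->
  derivable (G i) x (unitv i) <-> derivable (partial i d) x (unitv i).
Proof.
move=> fx; have Kx := f0 fx.
have dw : derivable w x (unitv i).
  by have [] := w_is_derive i Kx (KK Kx).
split=> [dG|]; last exact: (derivableM dw).
apply: (near_eq_derivable (f := (fun y => (w y)^-1) * G i)); last first.
  exact: (derivableM (derivableV (w_neq0 fx) dw) dG).
near=> y; rewrite (_ : (_ * _) y = (w y)^-1 * G i y)//.
rewrite /G mulKf//; apply: w_neq0; near: y.
by apply: cvgr_neq0; [exact: cf|].
Unshelve. all: by end_near. Qed.

Let G_derive i x : derivable (G i) x (unitv i) -> D i x = partial i (G i) x.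
Proof.
have [fx|fx] := eqVneq (f x) 0.
  rewrite /partial; have [_ ->] := G_derive0 i fx.
  by rewrite /D w0// w'0// !mul0r addr0.
move=> /(derivable_G i fx)/derivableP du.
have [_] := is_deriveM (w_is_derive i (f0 fx) (KK (f0 fx))) du.
by rewrite /partial /D /GRing.scale/= (mulrC (w' i x)) => ->.
Qed.

Let measurable_d_power q : measurable_fun setT (fun x => d x `^ q).
Proof.
apply: (measurableT_comp (measurable_powR q)).
exact: rV_continuous_measurable.
Qed.

Let measurable_w : measurable_fun setT w.
Proof.
by apply: measurable_funM; [exact: rV_continuous_measurable|].
Qed.

Let measurable_w' i : measurable_fun setT (w' i).
Proof.
(* The first factor becomes a partial derivative of the continuous [a], hence measurable. *)
have -> : w' i = fun x => partial i a x * d x `^ (1 - p)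
    + a x * ((1 - p) * d x `^ (- p) * partial i d x).
  by apply/funext => x; rewrite /partial; have [_ ->] := a_is_derive i x.
apply: measurable_funD; apply: measurable_funM => //.
- exact: measurable_partial.
- exact: rV_continuous_measurable.
- apply: measurable_funM; last exact: measurable_partial.
  exact: measurable_funM.
Qed.

(** Where [G i] is derivable, [D i] is the derivative of a continuous function. Elsewhere [f] is
    nonzero and the second derivative of [d] takes its default value [point], which leaves a
    measurable expression. *)
Lemma measurable_weight_derive i : measurable_fun setT (D i).
Proof.
have mA := measurable_derivable (unitv i) (@continuous_G i).
rewrite -(setUv [set x | derivable (G i) x (unitv i)]).
apply/measurable_funU => //; first exact: measurableC.
split.
  apply: (@eq_measurable_fun _ _ _ _ _ (partial i (G i))).
    by move=> x; rewrite inE /= => /G_derive.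
  exact: measurable_derive.
apply: (@eq_measurable_fun _ _ _ _ _
    (fun x => w x * point + w' i x * partial i d x)); last first.
  apply: measurable_funTS; apply: measurable_funD; apply: measurable_funM => //.
  exact: measurable_partial.
move=> x; rewrite inE /D /= => dG; congr (_ * _ + _).
have fx : f x != 0.
  by apply/eqP => fx; apply: dG; have [] := G_derive0 i fx.
apply/esym/dvgP => du; apply: dG; exact/(derivable_G i fx).
Qed.

Definition weight_derive_bound :=
  Cw * (`|point : R| + 6 * e^-1) + C'.

(** The second derivative is either a limit of quotients bounded by the Lipschitz constant
    [6 * e^-1], or the default value [point]. *)
Lemma partial2_le i x : K x ->
  `|partial i (partial i d) x| <= `|point : R| + 6 * e^-1.
Proof.
move=> Kx.
have [du|/dvgP du] := pselect (derivable (partial i d) x (unitv i)); last first.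
  by rewrite /partial /derive du lerDl mulr_ge0// invr_ge0 ltW.
apply: (@le_trans _ _ (6 * e^-1)); last by rewrite lerDr.
have lim : h^-1 *: ((partial i d \o shift x) (h *: unitv i) - partial i d x)
    @[h --> 0^'] --> partial i (partial i d) x by exact: du.
apply/ler_addgt0Pr => r r0; near (0 : R)^' => h.
have h0 : h != 0 by near: h; exact: nbhs_dnbhs_neq.
have he : `|h| < e by near: h; exact: dnbhs0_lt.
have : `|partial i (partial i d) x - h^-1 *: ((partial i d \o shift x)
    (h *: unitv i) - partial i d x)| <= r.
  by near: h; apply: cvgr_dist_le; [exact: lim|].
have : `|h^-1 *: ((partial i d \o shift x) (h *: unitv i) - partial i d x)|
    <= 6 * e^-1.
  have xy : enorm (x - (h *: unitv i + x)) = `|h|.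
    by rewrite opprD addrCA subrr addr0 enormN enormZ enorm_unitv mulr1.
  rewrite normrM normfV ler_pdivrMl ?normr_gt0// mulrC distrC.
  by rewrite -xy; apply: partial_d_lipschitz; rewrite ?xy.
move: (h^-1 *: _) => q q6 lq; rewrite -[X in `|X|](subrK q).
by rewrite (le_trans (ler_normD _ _))// addrC lerD.
Unshelve. all: by end_near. Qed.

Lemma weight_derive_le i x : `|D i x| <= weight_derive_bound.
Proof.
have e60 : 0 <= 6 * e^-1 by rewrite mulr_ge0// invr_ge0 ltW.
have [fx|/f0 Kx] := eqVneq (f x) 0.
  by rewrite /D w0// w'0// !mul0r addr0 normr0 addr_ge0// mulr_ge0// addr_ge0.
rewrite (le_trans (ler_normD _ _))// lerD// normrM.
  by rewrite ler_pM ?(w_le Kx) ?KK// partial2_le.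
by rewrite -[leRHS]mulr1 ler_pM ?(partial_d_le1 _ Kx) ?(w'_le _ Kx) ?KK.
Qed.

Lemma integral_weight_derive i :
  compact K -> (\int[lebesgue_rV n]_x (D i x)%:E = 0)%E.
Proof.
move=> /compact_coord_bound[M KM].
have K0 (x : 'rV[R]_n) k : M <= `|x 0 k| -> f x = 0.
  by move=> /KM Kx; apply/eqP/negPn/negP => /f0.
apply: (@integral_partial_lipschitz R n i (G i) (D i) L M weight_derive_bound).
- by rewrite ltr_wpDl// addr_ge0.
- exact: G_lipschitz.
- by move=> x k /K0 fx; rewrite /G w0 ?mul0r.
- exact: measurable_weight_derive.
- exact: weight_derive_le.
- by move=> x k /K0 fx; rewrite /D w0// w'0// !mul0r addr0.
- exact: G_derive.
Qed.

(** * The pointwise inequality and its integration *)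

Let lap_term x :=
  (1 - p * d x * laplacian d x / (p - 1)) * (`|f x| `^ p / d x `^ p).
Let grad_term x := `|dotv (grad d x) (grad f x)| `^ p.
Let s := (p - 1) / p.

Let s_ge0 : 0 <= s.
Proof. by apply: divr_ge0; rewrite ?subr_ge0 ltW. Qed.

Let p1_neq0 : p - 1 != 0. Proof. by rewrite subr_eq0 gt_eqF. Qed.

Let sum_w' x : K x -> \sum_i w' i x * partial i d x =
  p * Num.sg (f x) * (`|f x| `^ (p - 1) * d x `^ (1 - p))
    * dotv (grad d x) (grad f x) + (1 - p) * (a x * d x `^ (- p)).
Proof.
move=> Kx; have [_ u1 _] := dK Kx (KK Kx).
have -> : (1 - p) * (a x * d x `^ (- p)) =
    (1 - p) * (a x * d x `^ (- p)) * dotv (grad d x) (grad d x).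
  by rewrite -sqr_enorm u1 expr1n mulr1.
rewrite /dotv !mulr_sumr -big_split; apply: eq_bigr => i _.
by rewrite /w' !mxE /=; ring.
Qed.

(** Subtracting the [w'] part of the divergence leaves [w] times the Laplacian, and [d * d]^ (-
    p)[is]d [^ (1 - p)]. The Laplacian is thus traded for the divergence, which integrates to 0. *)
Let lap_termE x : lap_term x = a x * d x `^ (- p)
  - p / (p - 1) * \sum_i (D i x - w' i x * partial i d x).
Proof.
rewrite /lap_term /laplacian -powRN -/(a x).
have -> : \sum_i (D i x - w' i x * partial i d x) =
    w x * \sum_i partial i (partial i d) x.
  by rewrite mulr_sumr; apply: eq_bigr => i _; rewrite /D addrK.
have [fx|/f0 Kx] := eqVneq (f x) 0.
  by rewrite w0// /a fx normr0 powR0 ?gt_eqF// !mul0r !mulr0 subr0.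
have dx := d_gt0 Kx (KK Kx).
rewrite /w powRD; last by rewrite (gt_eqF dx) implybT.
by rewrite powRr1 ?(ltW dx)//; field; rewrite p1_neq0.
Qed.

Let quotient_power x q : K x -> `|f x| `^ q * d x `^ (- q) = (`|f x| / d x) `^ q.
Proof.
move=> Kx; have dx := d_gt0 Kx (KK Kx).
rewrite powRM ?normr_ge0 ?invr_ge0 ?(ltW dx)//; congr (_ * _).
by rewrite -[(d x)^-1]powR_inv1 ?(ltW dx)// -powRrM mulN1r.
Qed.

Let pointwise x :
  s `^ p * lap_term x + s `^ (p - 1) * \sum_i D i x <= grad_term x.
Proof.
have [Kx|Kx] := pselect (K x); last first.
  have fx : f x = 0 by apply/eqP/negPn/negP => /f0.
  rewrite /lap_term fx normr0 powR0 ?gt_eqF// mul0r mulr0 mulr0 add0r.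
  rewrite big1 ?mulr0 ?powR_ge0// => i _.
  by rewrite /D w0// w'0// !mul0r addr0.
have Hk := quotient_power p Kx.
have Qk := quotient_power (p - 1) Kx; rewrite opprB in Qk.
have k0 : 0 <= `|f x| / d x by rewrite divr_ge0// ltW// (d_gt0 Kx (KK Kx)).
rewrite /grad_term lap_termE sumrB sum_w'// /a Hk Qk.
move: (dotv _ _) (`|f x| / d x) k0 (\sum_i D i x) => g k k0 S.
have := young_power p1 (mulr_ge0 s_ge0 k0) (normr_ge0 g).
rewrite !(powRM _ s_ge0 k0) -(mulr_powRB1 s_ge0 p0).
rewrite -lerBlDl => Y; apply: le_trans Y; rewrite lerBrDr.
have sgg : Num.sg (f x) * g <= `|g|.
  rewrite (le_trans (ler_norm _))// normrM normr_sg.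
  by rewrite -[leRHS]mul1r ler_wpM2r// lern1 leq_b1.
have := ler_wpM2l (mulr_ge0 (ltW p0) (mulr_ge0 (powR_ge0 s (p - 1))
  (powR_ge0 k (p - 1)))) sgg.
apply: le_trans; rewrite le_eqVlt; apply/orP; left; apply/eqP.
rewrite /s; move: (_ `^ (p - 1)) (k `^ (p - 1)) (k `^ p) => q Q H.
by field; rewrite p1_neq0 gt_eqF.
Qed.

Let measurable_lap_term : measurable_fun setT lap_term.
Proof.
(* In this form the second derivatives occur only inside the measurable [D i]. *)
rewrite (funext lap_termE); apply: measurable_funB.
  by apply: measurable_funM; [exact: rV_continuous_measurable|].
apply: measurable_funM => //; apply: measurable_sum => i.
apply: measurable_funB; first exact: measurable_weight_derive.
by apply: measurable_funM => //; exact: measurable_partial.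
Qed.

Let dotv_gradE x :
  dotv (grad d x) (grad f x) = \sum_i partial i d x * partial i f x.
Proof. by apply: eq_bigr => i _; rewrite !mxE. Qed.

Let measurable_grad_term : measurable_fun setT grad_term.
Proof.
apply: (measurableT_comp (measurable_powR p)); apply: measurableT_comp => //.
rewrite (funext dotv_gradE); apply: measurable_sum => i.
by apply: measurable_funM; exact: measurable_partial.
Qed.

Let lap_term_le x : `|lap_term x| <= A `^ p * e `^ (- p)
  + `|p / (p - 1)| * \sum_(i < n) (weight_derive_bound + C').
Proof.
have [fx|/f0 Kx] := eqVneq (f x) 0.
  rewrite /lap_term fx normr0 powR0 ?gt_eqF// mul0r mulr0 normr0.
  rewrite addr_ge0 ?mulr_ge0 ?powR_ge0// sumr_ge0// => i _.
  by rewrite addr_ge0// (le_trans _ (weight_derive_le i x)).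
rewrite lap_termE (le_trans (ler_normB _ _))// lerD//.
  have [ed _ _] := dK Kx (KK Kx).
  by rewrite normrM !ger0_norm ?powR_ge0// ler_pM ?powR_ge0// ge0_ger_powRN// ltW.
rewrite normrM ler_wpM2l// (le_trans (ler_norm_sum _ _ _))//.
apply: ler_sum => i _; rewrite (le_trans (ler_normB _ _))// lerD//.
  exact: weight_derive_le.
by rewrite normrM -[leRHS]mulr1 ler_pM ?(partial_d_le1 _ Kx) ?(w'_le _ Kx) ?KK.
Qed.

Let lap_term0 x : ~ K x -> lap_term x = 0.
Proof.
move=> Kx; have fx : f x = 0 by apply/eqP/negPn/negP => /f0.
by rewrite /lap_term fx normr0 powR0 ?gt_eqF// mul0r mulr0.
Qed.

Let grad_term0 x : ~ K x -> grad_term x = 0.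
Proof.
move=> Kx; rewrite /grad_term dotv_gradE big1 ?normr0 ?powR0 ?gt_eqF// => i _.
by rewrite (@partial_eq0 _ _ K f i x)// mulr0.
Qed.

Let grad_term_le x : `|grad_term x| <= (\sum_(i < n) B) `^ p.
Proof.
have B'0 : 0 <= \sum_(i < n) B by rewrite sumr_ge0.
have [Kx|Kx] := pselect (K x); last by rewrite grad_term0// normr0 powR_ge0.
rewrite ger0_norm ?powR_ge0//; apply: ge0_ler_powR; rewrite ?nnegrE ?(ltW p0)//.
rewrite dotv_gradE (le_trans (ler_norm_sum _ _ _))//.
apply: ler_sum => i _; rewrite normrM -[leRHS]mul1r.
by rewrite ler_pM ?(partial_d_le1 _ Kx) ?KK.
Qed.

Let D0 i x : ~ K x -> D i x = 0.
Proof.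
move=> Kx; have fx : f x = 0 by apply/eqP/negPn/negP => /f0.
by rewrite /D w0// w'0// !mul0r addr0.
Qed.

Lemma weighted_inequality (Omega : set 'rV[R]_n) : compact K -> K `<=` Omega ->
  ((s `^ p)%:E * \int[lebesgue_rV n]_(x in Omega) (lap_term x)%:E
   <= \int[lebesgue_rV n]_(x in Omega) (grad_term x)%:E)%E.
Proof.
move=> cK KO.
(* All integrands vanish off [K], so the integrals extend to the whole space. *)
have full (F : _ -> R) : (forall x, ~ K x -> F x = 0) ->
    (\int[lebesgue_rV n]_(x in Omega) (F x)%:E
     = \int[lebesgue_rV n]_x (F x)%:E)%E.
  move=> F0; rewrite integral_mkcond; apply: eq_integral => x _.
  rewrite patchE; case: ifPn => //; rewrite notin_setE => Ox.
  by rewrite F0// => /KO.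
have integrableK (F : _ -> R) (C : R) :
    measurable_fun setT F -> (forall x, `|F x| <= C) ->
    (forall x, ~ K x -> F x = 0) ->
    (lebesgue_rV n).-integrable setT (EFin \o F).
  move=> mF FC F0; have [M KM] := compact_coord_bound cK.
  by apply: (lebesgue_rV_integrable mF FC) => x k /KM; exact: F0.
have iD i := integrableK _ _ (measurable_weight_derive i) (weight_derive_le i)
  (D0 i).
have il := integrableK _ _ measurable_lap_term lap_term_le lap_term0.
have ir := integrableK _ _ measurable_grad_term grad_term_le grad_term0.
rewrite !full//.
pose S x := \sum_i D i x.
have [iS] := integral_sum (index_enum 'I_n) iD; rewrite -/S => SE.
have S0 : (\int[lebesgue_rV n]_x (S x)%:E = 0)%E.
  by rewrite SE big1// => i _; exact: integral_weight_derive.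
(* The vanishing integral of the divergence is added to the left side with the coefficient from
   [pointwise]. *)
rewrite -integralZl// -[leLHS]adde0.
rewrite -(mule0 (s `^ (p - 1))%:E) -S0 -integralZl// -integralD//; last 2 first.
- exact: integrableZl.
- exact: integrableZl.
apply: le_integral => //.
  by apply: integrableD => //; exact: integrableZl.
by move=> x _; rewrite -!EFinM -EFinD lee_fin; exact: pointwise.
Qed.

End weighted_gradient.

(** * Application to the distance function *)

Lemma compact_support_bound (R : realType) (n : nat) (K : set 'rV[R]_n)
    (g : 'rV[R]_n -> R) : compact K -> continuous g ->
  (forall x, ~ K x -> g x = 0) ->
  exists2 A : R, 0 <= A & forall x, `|g x| <= A.
Proof.
move=> cK cg g0; have [KE|/set0P K0] := eqVneq K set0.
  by exists 0 => // x; rewrite g0 ?normr0// KE.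
have cng : continuous (fun x => `|g x|) by move=> x; exact: (cvg_norm (cg x)).
have [c _ cmax] := EVT_max_rV K0 cK (continuous_subspaceT cng).
exists `|g c| => // x; have [Kx|/g0 ->] := pselect (K x); last by rewrite normr0.
by apply: cmax; rewrite inE.
Qed.

(** [hproper] excludes the whole space, for which [edist] would take its conventional value 0. *)
Theorem theorem1 (R : realType) (n : nat) (Omega : set 'rV[R]_n) (p : R)
    (f : 'rV[R]_n -> R)
    (hn : (2 <= n)%N)
    (hdom : domain Omega)
    (hproper : ~` Omega !=set0)
    (hridge : closed_relative Omega (ridge Omega))
    (hgreen : green_formula Omega)
    (hp : 1 < p)
    (hf : C0infty (Omega `\` ridge Omega) f) :
  ((((p - 1) / p) `^ p)%:E *
     \int[lebesgue_rV n]_(x in Omega)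
       ((1 - p * delta Omega x * laplacian (delta Omega) x / (p - 1)) *
        (`|f x| `^ p / delta Omega x `^ p))%:E
   <= \int[lebesgue_rV n]_(x in Omega)
       (`|dotv (grad (delta Omega) x) (grad f x)| `^ p)%:E)%E.
Proof.
case: hf => fC cK KO; set K := closure _ in cK KO.
have [openO _] := hdom.
have [e e0 dK] := compact_delta_expansion hproper openO hridge cK KO.
(* The empty list of derivatives stands for [f] itself. *)
have [cf df] := fC [::].
have f0 x : f x != 0 -> K x by move=> fx; exact: subset_closure.
have nK x : ~ K x -> f x = 0 by move=> Kx; apply/eqP/negPn/negP => /f0.
have closedK : closed K by exact: closed_closure.
have [A A0 fA] := compact_support_bound cK cf nK.
have fB' i : exists B : R, 0 <= B /\ forall x, `|partial i f x| <= B.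
  have [B B0 fB] := compact_support_bound cK (df i).2 
    (fun x => @partial_eq0 R n K f i x closedK f0).
  by exists B.
have [B /all_and2[B0 fB]] := choice fB'.
(* The sum of the bounds [B i] is a common bound for all partial derivatives of [f]. *)
apply: (@weighted_inequality R n K (delta Omega) f e A (\sum_i B i) p) => //.
- by rewrite sumr_ge0.
- exact: continuous_delta.
- by move=> i; have [] := df i.
- move=> i x; rewrite (le_trans (fB i x))// (bigD1 i)//= lerDl.
  by rewrite sumr_ge0.
- by move=> x /KO[].
Qed.
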